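(* Let $E$ be a simple, closed, densely defined, symmetric operator with infinite deficiency indices on a complex separable infinite dimensional Hilbert space $\mathfrak{X}$, let $Y\subseteq\mathfrak{X}$ be a closed infinite dimensional subspace, and let $\Omega\subseteq\mathbb{C}$ be a nonempty open set, symmetric about the real axis, consisting of $Y$-regular points of $E$. Let $\mathcal{H}_1$ be the reproducing kernel Hilbert space of $\mathfrak{X}\oplus\mathfrak{X}$ valued functions on $\Omega$ constructed from $E$ (defined in the context). Then $\mathcal{H}_1$ is an $\mathcal{H}(U)$ space: there is an analytic function $U:\Omega\to B(\mathfrak{X}\oplus\mathfrak{X})$ satisfying $U(\lambda)JU(\bar\lambda)^*=J=U(\bar\lambda)^*JU(\lambda)$ for all $\lambda\in\Omega$, with signature operator $J=J_1=\begin{bmatrix}0&I\\ I&0\end{bmatrix}$ on $\mathfrak{X}\oplus\mathfrak{X}$, such that $\mathcal{H}_1=\mathcal{H}(U)$.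
   Context: $B(\mathfrak{K})$ is the space of bounded linear operators on a Hilbert space $\mathfrak{K}$. A symmetric operator $E$ is simple if it has no nonzero reducing subspace on which it is self-adjoint (equivalently $\bigcap_{\xi\in\mathbb{C}\setminus\mathbb{R}}\mathrm{rng}(E-\xi I)=\{0\}$). Write $\mathfrak{M}_\xi=\mathrm{rng}(E-\xi I)$. For a closed subspace $Y$ of $\mathfrak{X}$, a point $\xi\in\mathbb{C}$ is called $Y$-regular for $E$ if $\mathfrak{M}_\xi$ is closed and $\mathfrak{X}=\mathfrak{M}_\xi\dotplus Y$ (direct sum). Every $Y$-regular point is a point of regular type of $E$, i.e. there is $c_\xi>0$ with $\|(E-\xi I)g\|\ge c_\xi\|g\|$ for all $g\in\mathcal{D}(E)$. For $\xi\in\Omega$, $P_Y(\xi)\in B(\mathfrak{X})$ is the projection onto $Y$ along $\mathfrak{M}_\xi$, and $\tau_Y(\xi)\in B(\mathfrak{X})$ is $\tau_Y(\xi)f=(E-\xi I)^{-1}(I-P_Y(\xi))f$; thus $f=(E-\xi I)\tau_Y(\xi)f+P_Y(\xi)f$. Construction of $\mathcal{H}_1$: for $f\in\mathfrak{X}$ and $\xi\in\Omega$ put $\begin{bmatrix}f_Y\\ \tilde f_Y\end{bmatrix}(\xi)=\begin{bmatrix}P_Y(\xi)f\\ \frac{1}{\pi i}\tau_Y(\xi)f\end{bmatrix}\in\mathfrak{X}\oplus\mathfrak{X}$. Then $\mathcal{H}_1=\left\{\begin{bmatrix}f_Y\\ \tilde f_Y\end{bmatrix}:f\in\mathfrak{X}\right\}$,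 with inner product $\left\langle\begin{bmatrix}f_Y\\ \tilde f_Y\end{bmatrix},\begin{bmatrix}g_Y\\ \tilde g_Y\end{bmatrix}\right\rangle_{\mathcal{H}_1}=2\langle f,g\rangle_{\mathfrak{X}}$ (well defined because $f\mapsto\begin{bmatrix}f_Y\\ \tilde f_Y\end{bmatrix}$ is injective). $\mathcal{H}(U)$ spaces: let $J$ be a unitary self-adjoint operator on a Hilbert space $\mathfrak{K}$ and $U:\Omega\to B(\mathfrak{K})$ analytic with $U(\lambda)JU(\bar\lambda)^*=J=U(\bar\lambda)^*JU(\lambda)$ for all $\lambda\in\Omega$. Put $\rho_\xi(\lambda)=-2\pi i(\lambda-\bar\xi)$ and $K^U_\xi(\lambda)=\frac{J-U(\lambda)JU(\xi)^*}{\rho_\xi(\lambda)}$ if $\lambda\ne\bar\xi$, $K^U_\xi(\bar\xi)=\frac{U'(\bar\xi)JU(\xi)^*}{2\pi i}$. When this kernel is positive on $\Omega\times\Omega$ (i.e. $\sum_{i,j}\langle K^U_{\omega_j}(\omega_i)u_j,u_i\rangle\ge0$ for all finite choices of $\omega_i\in\Omega$, $u_i\in\mathfrak{K}$), $\mathcal{H}(U)$ denotes the unique reproducing kernel Hilbert space of $\mathfrak{K}$-valued analytic functions on $\Omega$ with reproducing kernel $K^U$. A Hilbert space $\mathcal{H}$ of $\mathfrak{K}$-valued functions on $\Omega$ has reproducing kernel $K$ if $K_\omega u\in\mathcal{H}$ and $\langle f,K_\omega u\rangle_{\mathcal{H}}=\langle f(\omega),u\rangle$ for all $\omega\in\Omega$,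 $u\in\mathfrak{K}$, $f\in\mathcal{H}$. *)

(* Defs.v *)
From HB Require Import structures.
From mathcomp Require Import all_boot all_order all_algebra.
From mathcomp Require Import all_classical all_reals all_analysis.
From mathcomp Require Import complex ring.

Set Implicit Arguments.
Unset Strict Implicit.
Unset Printing Implicit Defensive.

Import Order.TTheory GRing.Theory Num.Theory.
Import numFieldNormedType.Exports.

Local Open Scope classical_set_scope.
Local Open Scope ring_scope.

HB.mixin Record NormedModule_isHilbert (R : realType) V
    & CompleteNormedModule R[i] V := {
  inner : {dot V for Num.conj};
  normr_inner : forall x : V, `|x| = sqrtC (inner x x)
}.

#[short(type="hilbertType")]
HB.structure Definition Hilbert (R : realType) :=
  {V of CompleteNormedModule R[i] V & NormedModule_isHilbert R V}.

Fact inner_normr (R : realType) (V : hilbertType R) (x : V) :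
  inner x x = `|x| ^+ 2.
Proof. by rewrite normr_inner sqrtCK. Qed.

(* The product type [V * W] already carries the sup norm; [hsum] is the copy of
   it that carries the Hilbert-space direct sum norm. *)
Definition hsum (V W : Type) : Type := (V * W)%type.

HB.instance Definition _ (R : realType) (V W : lmodType R[i]) :=
  GRing.Lmodule.copy (hsum V W) (V * W)%type.

Section hsum.
Context (R : realType) (V W : hilbertType R).
Implicit Types x y : hsum V W.

Definition hsum_inner x y : R[i] := inner x.1 y.1 + inner x.2 y.2.

Fact hsum_inner_zmodl y : zmod_morphism (hsum_inner^~ y).
Proof. by move=> u v; rewrite /hsum_inner/= !linearBl opprD addrACA. Qed.

Fact hsum_inner_zmodr x : zmod_morphism (hsum_inner x).
Proof. by move=> u v; rewrite /hsum_inner/= !linearBr opprD addrACA. Qed.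

Fact hsum_inner_scalel y : scalable_for *%R (hsum_inner^~ y).
Proof. by move=> a u; rewrite /hsum_inner/= !linearZl_LR mulrDr. Qed.

Fact hsum_inner_scaler x : scalable_for (Num.conj \; *%R) (hsum_inner x).
Proof. by move=> a u; rewrite /hsum_inner/= !linearZr_LR mulrDr. Qed.

HB.instance Definition _ := isBilinear.Build R[i] (hsum V W) (hsum V W) R[i]
  *%R (Num.conj \; *%R) hsum_inner
  hsum_inner_zmodl hsum_inner_zmodr hsum_inner_scalel hsum_inner_scaler.

Fact hsum_inner_herm x y :
  hsum_inner x y = (-1) ^+ false * (hsum_inner y x)^*.
Proof.
by rewrite /hsum_inner rmorphD (hermC _ x.1) (hermC _ x.2) !expr0 !mul1r.
Qed.

HB.instance Definition _ := isHermitianSesquilinear.Build R[i] (hsum V W)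
  false Num.conj hsum_inner hsum_inner_herm.

Lemma hsum_innerE x : hsum_inner x x = `|x.1| ^+ 2 + `|x.2| ^+ 2.
Proof. by rewrite /hsum_inner !inner_normr. Qed.

Fact hsum_inner_gt0 x : x != 0 -> 0 < hsum_inner x x.
Proof.
move=> x0; rewrite hsum_innerE lt_def addr_ge0 ?exprn_ge0// andbT.
apply: contra x0; rewrite paddr_eq0 ?exprn_ge0// !expf_eq0/= !normr_eq0.
by case: x => a b /= /andP[/eqP-> /eqP->].
Qed.

HB.instance Definition _ := isDotProduct.Build R[i] (hsum V W) hsum_inner
  hsum_inner_gt0.

Definition hsum_dot : {dot hsum V W for Num.conj} := hsum_inner.

Definition hsum_norm x : R[i] := sqrtC (hsum_inner x x).

Lemma hsum_norm_ge0 x : 0 <= hsum_norm x.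
Proof. by rewrite /hsum_norm sqrtC_ge0 hsum_innerE addr_ge0 ?exprn_ge0. Qed.

Fact minkowski2 (p q r s : R[i]) : 0 <= p -> 0 <= q -> 0 <= r -> 0 <= s ->
  sqrtC ((p + r) ^+ 2 + (q + s) ^+ 2) <=
  sqrtC (p ^+ 2 + q ^+ 2) + sqrtC (r ^+ 2 + s ^+ 2).
Proof.
move=> p0 q0 r0 s0.
set A := sqrtC (p ^+ 2 + q ^+ 2); set B := sqrtC (r ^+ 2 + s ^+ 2).
have A0 : 0 <= A by rewrite sqrtC_ge0 addr_ge0 ?exprn_ge0.
have B0 : 0 <= B by rewrite sqrtC_ge0 addr_ge0 ?exprn_ge0.
have AE : A ^+ 2 = p ^+ 2 + q ^+ 2 by rewrite sqrtCK.
have BE : B ^+ 2 = r ^+ 2 + s ^+ 2 by rewrite sqrtCK.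
have C0 : 0 <= (p + r) ^+ 2 + (q + s) ^+ 2 by rewrite addr_ge0 ?exprn_ge0 ?addr_ge0.
have key : p * r + q * s <= A * B.
  have pq0 : 0 <= p * r + q * s by rewrite addr_ge0 ?mulr_ge0.
  rewrite -(@ler_pXn2r _ 2) ?nnegrE ?mulr_ge0// exprMn AE BE -subr_ge0.
  have -> : (p ^+ 2 + q ^+ 2) * (r ^+ 2 + s ^+ 2) - (p * r + q * s) ^+ 2 =
    (p * s - q * r) ^+ 2 by ring.
  by rewrite real_exprn_even_ge0// realB ?ger0_real ?mulr_ge0.
have AB0 : 0 <= A + B by rewrite addr_ge0.
rewrite -(@ler_pXn2r _ 2) ?nnegrE ?sqrtC_ge0// sqrtCK.
rewrite (sqrrD A) AE BE -subr_ge0.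
have -> : p ^+ 2 + q ^+ 2 + A * B *+ 2 + (r ^+ 2 + s ^+ 2)
  - ((p + r) ^+ 2 + (q + s) ^+ 2) = (A * B - (p * r + q * s)) *+ 2 by ring.
by rewrite mulrn_wge0// subr_ge0.
Qed.

Fact hsum_normD x y : hsum_norm (x + y) <= hsum_norm x + hsum_norm y.
Proof.
rewrite /hsum_norm !hsum_innerE (le_trans _ (minkowski2 _ _ _ _))//.
rewrite ler_sqrtC ?nnegrE ?addr_ge0 ?exprn_ge0 ?addr_ge0//.
by apply: lerD; rewrite ler_pXn2r ?nnegrE ?addr_ge0// ler_normD.
Qed.

Fact hsum_normZ (a : R[i]) x : hsum_norm (a *: x) = `|a| * hsum_norm x.
Proof.
rewrite /hsum_norm !hsum_innerE/= !normrZ !exprMn -mulrDr.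
by rewrite sqrtCM ?nnegrE ?addr_ge0 ?exprn_ge0// sqrCK.
Qed.

Fact hsum_norm_eq0 x : hsum_norm x = 0 -> x = 0.
Proof.
move/eqP; rewrite sqrtC_eq0 hsum_innerE paddr_eq0 ?exprn_ge0//.
rewrite !expf_eq0/= !normr_eq0.
by case: x => a b /= /andP[/eqP-> /eqP->].
Qed.

HB.instance Definition _ := Lmodule_isNormed.Build R[i] (hsum V W)
  hsum_normD hsum_normZ hsum_norm_eq0.

Fact hsum_complete (F : set_system (hsum V W)) :
  ProperFilter F -> cauchy F -> cvg F.
Proof.
move=> FF Fc.
have n1 x : `|x.1| <= `|x|.
  rewrite [leRHS]/(hsum_norm x) /hsum_norm hsum_innerE.
  rewrite -(@ler_pXn2r _ 2) ?nnegrE ?sqrtC_ge0 ?addr_ge0 ?exprn_ge0// sqrtCK.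
  by rewrite lerDl exprn_ge0.
have n2 x : `|x.2| <= `|x|.
  rewrite [leRHS]/(hsum_norm x) /hsum_norm hsum_innerE.
  rewrite -(@ler_pXn2r _ 2) ?nnegrE ?sqrtC_ge0 ?addr_ge0 ?exprn_ge0// sqrtCK.
  by rewrite lerDr exprn_ge0.
have n12 x : `|x| <= `|x.1| + `|x.2|.
  rewrite [leLHS]/(hsum_norm x) /hsum_norm hsum_innerE.
  rewrite -(@ler_pXn2r _ 2) ?nnegrE ?sqrtC_ge0 ?addr_ge0 ?exprn_ge0// sqrtCK.
  by rewrite sqrrD addrAC lerDl mulrn_wge0// mulr_ge0.
have c1 : cvg ((fun x : hsum V W => x.1) @ F).
  apply: cauchy_cvg; apply/cauchy_exP => e e0.
  have [x Fx] : exists x, F (ball x e) by exact/(cauchyP F).1.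
  exists x.1; suff: F [set y | ball x.1 e y.1] by [].
  apply: filterS Fx => y; rewrite /= -!ball_normE/=.
  exact: le_lt_trans (n1 (x - y)).
have c2 : cvg ((fun x : hsum V W => x.2) @ F).
  apply: cauchy_cvg; apply/cauchy_exP => e e0.
  have [x Fx] : exists x, F (ball x e) by exact/(cauchyP F).1.
  exists x.2; suff: F [set y | ball x.2 e y.2] by [].
  apply: filterS Fx => y; rewrite /= -!ball_normE/=.
  exact: le_lt_trans (n2 (x - y)).
apply/cvg_ex; exists ((lim ((fun x : hsum V W => x.1) @ F),
  lim ((fun x : hsum V W => x.2) @ F)) : hsum V W).
apply/cvgrPdist_lt => e e0.
have e20 : 0 < e / 2 by rewrite divr_gt0.
have /cvgrPdist_lt/(_ _ e20) d1 := c1.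
have /cvgrPdist_lt/(_ _ e20) d2 := c2.
near=> t; apply: le_lt_trans (n12 _) _; rewrite (splitr e).
by apply: ltrD; near: t; [exact: d1|exact: d2].
Unshelve. all: by end_near. Qed.

HB.instance Definition _ := Uniform_isComplete.Build (hsum V W) hsum_complete.

HB.instance Definition _ := NormedModule_isHilbert.Build R (hsum V W)
  (inner := hsum_dot) (fun=> erefl).
End hsum.

Section Operators.
Context {R : realType}.
Implicit Types V X : hilbertType R.

Definition lin_subspace V (S : set V) : Prop :=
  S 0 /\ forall (a : R[i]) x y, S x -> S y -> S (a *: x + y).

Definition infinite_dim V (S : set V) : Prop :=
  forall n, exists v : 'I_n -> V, (forall i, S (v i)) /\
    forall c : 'I_n -> R[i], \sum_i c i *: v i = 0 -> forall i, c i = 0.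

Definition separable V : Prop := exists2 A : set V, countable A & dense A.

Definition ortho V (M : set V) : set V :=
  [set y | forall x, M x -> inner x y = 0].

(* A possibly unbounded operator; the values of [lop_fun] off the domain are
   irrelevant. *)
Record linop X := LinOp {
  dom : set X;
  lop_fun :> X -> X;
  dom_subspace : lin_subspace dom;
  lop_linear : forall (a : R[i]) f g, dom f -> dom g ->
    lop_fun (a *: f + g) = a *: lop_fun f + lop_fun g
}.

Definition closed_op X (E : linop X) : Prop :=
  closed [set p : X * X | dom E p.1 /\ p.2 = E p.1].

Definition symmetric_op X (E : linop X) : Prop :=
  forall f g, dom E f -> dom E g -> inner (E f) g = inner f (E g).

(* M is closed, dom E splits along M and its orthogonal complement, and E maps
   each of the two pieces into M and its orthogonal complement respectively. *)
Definition reducing X (E : linop X) (M : set X) : Prop :=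
  [/\ closed M, lin_subspace M,
      forall f, dom E f -> exists g h,
        [/\ dom E g, dom E h, M g, ortho M h & f = g + h],
      forall g, dom E g -> M g -> M (E g) &
      forall h, dom E h -> ortho M h -> ortho M (E h)].

(* The restriction of E to dom E `&` M, as an operator in the Hilbert space M,
   is densely defined and equal to its adjoint. *)
Definition selfadjoint_on X (E : linop X) (M : set X) : Prop :=
  M `<=` closure (dom E `&` M) /\
  forall g h, M g -> M h ->
    (forall f, dom E f -> M f -> inner (E f) g = inner f h) <->
    (dom E g /\ E g = h).

Definition simple_op X (E : linop X) : Prop :=
  forall M, reducing E M -> selfadjoint_on E M -> M = [set 0].

(* (g, h) is in the graph of the adjoint of E. *)
Definition adjoint_graph X (E : linop X) (g h : X) : Prop :=
  forall f, dom E f -> inner (E f) g = inner f h.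

Definition deficiency_space X (E : linop X) (z : R[i]) : set X :=
  [set g | adjoint_graph E g (z *: g)].

Definition infinite_deficiency_indices X (E : linop X) : Prop :=
  infinite_dim (deficiency_space E 'i) /\
  infinite_dim (deficiency_space E (- 'i)).

Definition rng X (E : linop X) (xi : R[i]) : set X :=
  [set E g - xi *: g | g in dom E].

Definition regular_point X (E : linop X) (Y : set X) (xi : R[i]) : Prop :=
  [/\ closed (rng E xi),
      forall f, exists m y, [/\ rng E xi m, Y y & f = m + y] &
      rng E xi `&` Y = [set 0]].

(* At a Y-regular point the y selected here exists and is unique. *)
Definition P_ X (E : linop X) (Y : set X) (xi : R[i]) (f : X) : X :=
  xget 0 [set y | Y y /\ rng E xi (f - y)].

Definition tau_ X (E : linop X) (Y : set X) (xi : R[i]) (f : X) : X :=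
  xget 0 [set g | dom E g /\ E g - xi *: g = f - P_ E Y xi f].

Definition bounded_op V (A : V -> V) : Prop :=
  linear A /\ exists M : R[i], forall x, `|A x| <= M * `|x|.

(* For bounded A the vector selected here exists (Riesz) and is unique. *)
Definition adjoint V (A : V -> V) (y : V) : V :=
  xget 0 [set z | forall x, inner (A x) y = inner x z].

Definition signature_op V (J : V -> V) : Prop :=
  [/\ bounded_op J, forall x y, inner (J x) y = inner x (J y) &
      forall x, J (J x) = x].

(* D is the derivative at z of the operator-valued function U, in operator
   norm. *)
Definition op_is_derive V (U : R[i] -> V -> V) (z : R[i]) (D : V -> V) : Prop :=
  bounded_op D /\
  forall e : R[i], 0 < e -> \forall h \near (0 : R[i]^o)^',
    forall x, `|h^-1 *: (U (h + z) x - U z x) - D x| <= e * `|x|.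

Definition op_derive V (U : R[i] -> V -> V) (z : R[i]) : V -> V :=
  xget (fun=> 0) [set D | op_is_derive U z D].

Definition op_analytic V (Omega : set R[i]) (U : R[i] -> V -> V) : Prop :=
  forall z, Omega z -> bounded_op (U z) /\ exists D, op_is_derive U z D.

Definition J_identity V (Omega : set R[i]) (J : V -> V) (U : R[i] -> V -> V)
    : Prop :=
  forall la, Omega la -> forall u,
    U la (J (adjoint (U la^*) u)) = J u /\
    adjoint (U la^*) (J (U la u)) = J u.

End Operators.

Section FunctionSpaces.
Context {R : realType}.
Implicit Types V : hilbertType R.

(* Functions on Omega are represented by functions on the whole plane that
   vanish off Omega. *)
Definition on_set V (Omega : set R[i]) (F : R[i] -> V) : R[i] -> V :=
  patch (fun=> 0) Omega F.

Definition analytic_on V (Omega : set R[i]) (F : R[i] -> V) : Prop :=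
  forall z, Omega z -> derivable (F : R[i]^o -> V) z 1.

(* The values of [fs_inner] off [fs_carrier] are irrelevant. *)
Record fun_space V := FunSpace {
  fs_carrier : set (R[i] -> V);
  fs_inner : (R[i] -> V) -> (R[i] -> V) -> R[i]
}.

Definition fs_norm V (H : fun_space V) (F : R[i] -> V) : R[i] :=
  sqrtC (fs_inner H F F).

Record hilbert_fun_space V (Omega : set R[i]) (H : fun_space V) : Prop := {
  hfs_off : forall F z, fs_carrier H F -> ~ Omega z -> F z = 0;
  hfs_0 : fs_carrier H (fun=> 0);
  hfs_lin : forall (a : R[i]) F G, fs_carrier H F -> fs_carrier H G ->
    fs_carrier H (fun z => a *: F z + G z);
  hfs_inner_lin : forall (a : R[i]) F G K, fs_carrier H F -> fs_carrier H G -> fs_carrier H K ->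
    fs_inner H (fun z => a *: F z + G z) K =
    a * fs_inner H F K + fs_inner H G K;
  hfs_inner_herm : forall F G, fs_carrier H F -> fs_carrier H G ->
    fs_inner H F G = (fs_inner H G F)^*;
  hfs_inner_pos : forall F, fs_carrier H F -> F != (fun=> 0) ->
    0 < fs_inner H F F;
  hfs_complete : forall F_ : nat -> R[i] -> V, (forall n, fs_carrier H (F_ n)) ->
    (forall e : R[i], 0 < e -> exists N : nat, forall m n : nat,
       (N <= m)%N -> (N <= n)%N -> fs_norm H (fun z => F_ m z - F_ n z) < e) ->
    exists2 F, fs_carrier H F & forall e : R[i], 0 < e ->
       exists N : nat, forall n : nat,
       (N <= n)%N -> fs_norm H (fun z => F_ n z - F z) < e
}.

(* [K om la] is the value of the kernel function K_om at la. *)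
Definition reproducing_kernel V (Omega : set R[i]) (K : R[i] -> R[i] -> V -> V)
    (H : fun_space V) : Prop :=
  forall om, Omega om -> forall u,
    fs_carrier H (on_set Omega (fun la => K om la u)) /\
    forall F, fs_carrier H F ->
      fs_inner H F (on_set Omega (fun la => K om la u)) = inner (F om) u.

Definition positive_kernel V (Omega : set R[i]) (K : R[i] -> R[i] -> V -> V)
    : Prop :=
  forall n (om : 'I_n -> R[i]) (u : 'I_n -> V), (forall i, Omega (om i)) ->
    0 <= \sum_i \sum_j inner (K (om j) (om i) (u j)) (u i).

Definition rho (xi la : R[i]) : R[i] :=
  - (2 * (pi : R)%:C%C * 'i) * (la - xi^*).

Definition HU_kernel V (J : V -> V) (U : R[i] -> V -> V) (xi la : R[i]) (u : V)
    : V :=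
  if la == xi^*
  then (2 * (pi : R)%:C%C * 'i)^-1 *:
         op_derive U xi^* (J (adjoint (U xi) u))
  else (rho xi la)^-1 *: (J u - U la (J (adjoint (U xi) u))).

(* H = H(U): as H(U) is the unique space with these properties, equality is
   expressed by H having them. *)
Record is_HU V (Omega : set R[i]) (J : V -> V) (U : R[i] -> V -> V)
    (H : fun_space V) : Prop := {
  HU_positive : positive_kernel Omega (HU_kernel J U);
  HU_hilbert : hilbert_fun_space Omega H;
  HU_analytic : forall F, fs_carrier H F -> analytic_on Omega F;
  HU_reproducing : reproducing_kernel Omega (HU_kernel J U) H
}.

End FunctionSpaces.

Section H1.
Context {R : realType} {X : hilbertType R}.
Variables (E : linop X) (Y : set X) (Omega : set R[i]).

Definition J1 (x : hsum X X) : hsum X X := (x.2, x.1).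

Definition H1_fun (f : X) : R[i] -> hsum X X :=
  on_set Omega (fun xi =>
    (P_ E Y xi f, ((pi : R)%:C%C * 'i)^-1 *: tau_ E Y xi f) : hsum X X).

Definition H1_rep (F : R[i] -> hsum X X) : X := xget 0 [set f | H1_fun f = F].

Definition H1 : fun_space (hsum X X) := {|
  fs_carrier := range H1_fun;
  fs_inner := fun F G => 2 * inner (H1_rep F) (H1_rep G)
|}.

Lemma H1_fun_inj : Omega !=set0 ->
  (forall xi, Omega xi -> regular_point E Y xi) -> injective H1_fun.
Proof.
move=> [xi Oxi] /(_ xi Oxi)[_ dec _] f g fg.
have tauE k : E (tau_ E Y xi k) - xi *: tau_ E Y xi k = k - P_ E Y xi k.
  have [m [y [rm Yy km]]] := dec k.
  have [_ [w dw wk]] : Y (P_ E Y xi k) /\ rng E xi (k - P_ E Y xi k).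
    by apply: (@xgetPex _ _ [set y | Y y /\ _]); exists y; split=> //; rewrite km addrK.
  have [] // : dom E (tau_ E Y xi k) /\
      E (tau_ E Y xi k) - xi *: tau_ E Y xi k = k - P_ E Y xi k.
  by apply: (@xgetPex _ _ [set g | dom E g /\ _]); exists w.
have := congr1 (fun F : R[i] -> hsum X X => F xi) fg.
rewrite /H1_fun /on_set !patchT ?inE// => -[PE /scalerI tE].
have {}tE : tau_ E Y xi f = tau_ E Y xi g.
  apply: tE; rewrite invr_eq0 mulf_eq0 negb_or neq0Ci andbT.
  by rewrite (inj_eq (@complexI _) _ 0) gt_eqF// pi_gt0.
by have := tauE f; rewrite tE tauE PE => /addIr.
Qed.

Lemma H1_innerE : Omega !=set0 ->
  (forall xi, Omega xi -> regular_point E Y xi) ->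
  forall f g, fs_inner H1 (H1_fun f) (H1_fun g) = 2 * inner f g.
Proof.
move=> O0 reg f g; rewrite /H1/=; congr (_ * _).
have repE k : H1_rep (H1_fun k) = k.
  apply: H1_fun_inj => //.
  by apply: (@xgetPex _ 0 [set h | H1_fun h = H1_fun k]); exists k.
by rewrite !repE.
Qed.

End H1.

(* Main.v *)
(* Write w' for the complex conjugate of w. Let F(xi) f = (P(xi) f, tau(xi) f / (pi i)),
   so that H1 has the reproducing kernel K_w(la) = F(la) F(w)^* / 2, and put
   N_w(la) = J - rho_w(la) K_w(la). The operators tau(xi) satisfy the resolvent
   identity, which gives F(la) = F(mu) (1 + (la - mu) tau(la)), and the symmetry of
   E gives tau(w') - tau(w)^* = pi i F(w)^* J F(w'). Together they yield the cocycle
   identity N_w(la) J N_nu(w') = N_nu(la), with N_w(w') = J.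

   Fix beta in Omega below the real axis, and let N = N_beta(beta), whose inverse
   is J N_beta'(beta') J. If N^-1 = W J W^* with W^* N W = J, then
   U(la) = N_beta(la) W satisfies U(la) J U(w)^* = N_w(la) for all la and w in
   Omega, which is what is needed. To find W, note that N is J plus a positive
   operator, N^-1 is J minus a positive operator, and F(beta) y = (y, 0) for y in Y.
   With G the orthogonal projection onto the complement of Y, it follows that N is
   uniformly positive on the vectors (p, G p), and N^-1 uniformly negative on the
   vectors (- G q, q); these two families are complementary, and normalizing N on
   them by inverse square roots produces W. *)

Require Import Defs.
From HB Require Import structures.
From mathcomp Require Import all_boot all_order all_algebra.
From mathcomp Require Import all_classical all_reals all_analysis.
From mathcomp Require Import complex ring lra.

Set Implicit Arguments.
Unset Strict Implicit.
Unset Printing Implicit Defensive.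

Import Order.TTheory GRing.Theory Num.Theory.
Import numFieldNormedType.Exports.

Local Open Scope classical_set_scope.
Local Open Scope ring_scope.

(** * Real-valued norms and orthogonal projections *)

Section RealNorm.
Context {R : realType}.

(** The norm takes values in [R[i]]; its real part lives in the ordered field [R], where infima, the
    archimedean property and [lra] apply. *)
Definition nm {V : normedZmodType R[i]} (x : V) : R := complex.Re `|x|.

Section Zmod.
Context {V : normedZmodType R[i]}.
Implicit Types x y z : V.

Lemma nmE x : `|x| = (nm x)%:C%C.
Proof. by rewrite /nm RRe_real// ger0_real. Qed.

Lemma nm_ge0 x : 0 <= nm x.
Proof. by rewrite -ler0c -nmE. Qed.

Lemma nm0 : nm (0 : V) = 0.
Proof. by rewrite /nm normr0. Qed.

Lemma nm_eq0 x : nm x = 0 -> x = 0.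
Proof. by move=> x0; apply/normr0_eq0; rewrite nmE x0. Qed.

Lemma nmD x y : nm (x + y) <= nm x + nm y.
Proof. by rewrite -lecR rmorphD/= -!nmE ler_normD. Qed.

Lemma nmN x : nm (- x) = nm x.
Proof. by rewrite /nm normrN. Qed.

Lemma nmC x y : nm (x - y) = nm (y - x).
Proof. by rewrite -nmN opprB. Qed.

Lemma nm_trans y x z : nm (x - z) <= nm (x - y) + nm (y - z).
Proof. by apply: le_trans (nmD _ _); rewrite addrA subrK. Qed.

End Zmod.

Lemma nmM (a b : R[i]) : nm (a * b) = nm a * nm b.
Proof. by apply: (@complexI R); rewrite rmorphM/= -!nmE normrM. Qed.

Lemma nmr (a : R) : nm a%:C%C = `|a|.
Proof. by rewrite /nm normc_def/= expr0n addr0 sqrtr_sqr. Qed.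

Lemma nm2 : nm (2 : R[i]) = 2.
Proof. by rewrite -(rmorph_nat (real_complex R)) nmr ger0_norm. Qed.

Lemma nmZ {V : normedModType R[i]} (a : R[i]) (x : V) :
  nm (a *: x) = nm a * nm x.
Proof. by apply: (@complexI R); rewrite rmorphM/= -!nmE normrZ. Qed.

Lemma Re_le_nm (a : R[i]) : complex.Re a <= nm a.
Proof.
by apply: le_trans (ler_norm _) _; rewrite -lecR -nmE normc_ge_Re.
Qed.

Lemma nm_conj (a : R[i]) : nm a^* = nm a.
Proof. by rewrite /nm norm_conjC. Qed.

Lemma closed_nm {V : normedModType R[i]} (S : set V) (x : V) : closed S ->
  (forall e : R, 0 < e -> exists2 y, S y & nm (x - y) < e) -> S x.
Proof.
move=> cS h; apply: cS => B /nbhs_ballP[e /= e0 eB].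
have eE : (complex.Re e)%:C%C = e by rewrite RRe_real// gtr0_real.
have [|y Sy xy] := h (complex.Re e).
  by rewrite -ltcR eE.
exists y; split=> //; apply: eB; rewrite -ball_normE/= nmE -eE ltcR.
exact: xy.
Qed.

Lemma geo_small (K q e : R) : 0 <= q < 1 -> 0 < e ->
  exists n, forall m, (n <= m)%N -> K * q ^+ m < e.
Proof.
move=> /andP[q0 q1] e0.
have /(@cvg_geometric R K) /cvgrPdist_lt/(_ _ e0)[N _ NP] : `|q| < 1.
  by rewrite ger0_norm.
exists N => m Nm; have := NP m Nm; rewrite /= sub0r normrN.
exact/le_lt_trans/ler_norm.
Qed.

Lemma geo_le0 (K q a : R) : 0 <= q < 1 -> (forall n, a <= K * q ^+ n) -> a <= 0.
Proof.
move=> q01 aK; apply/ler_addgt0Pr => e e0; rewrite add0r.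
have [n nP] := geo_small K q01 e0.
exact/ltW/(le_lt_trans (aK n))/nP.
Qed.

(** The limits in the projection, the gliding hump, the Neumann series and the square root all come
    from here. The explicit rate lets an identity at [l] be checked up to [K * q ^+ n] and concluded
    by [geo_le0]. *)
Lemma geo_lim (V : completeNormedModType R[i]) (x : nat -> V) (C q : R) :
  0 <= C -> 0 <= q < 1 -> (forall n, nm (x n.+1 - x n) <= C * q ^+ n) ->
  exists l, forall n, nm (l - x n) <= C / (1 - q) * q ^+ n.
Proof.
move=> C0 q01 xC; have /andP[q0 q1] := q01.
have q1' : 0 < 1 - q by rewrite subr_gt0.
set K := C / (1 - q).
have K0 : 0 <= K by rewrite divr_ge0// ltW.
have KC : K * (1 - q) = C by rewrite /K divfK// gt_eqF.
have dist n m : nm (x (n + m)%N - x n) <= K * q ^+ n.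
  (* The factor [1 - q ^+ m] of the partial geometric sum is what lets the induction on [m]
     close. *)
  suff : nm (x (n + m)%N - x n) <= K * q ^+ n * (1 - q ^+ m).
    move/le_trans; apply; apply: ler_piMr; first by rewrite mulr_ge0 ?exprn_ge0.
    by rewrite gerBl exprn_ge0.
  elim: m => [|m ih]; first by rewrite addn0 subrr nm0 expr0 subrr mulr0.
  apply: le_trans (nm_trans (x (n + m)%N) _ _) _.
  rewrite addnS; apply: le_trans (lerD (xC _) ih) _.
  by rewrite -KC exprD exprS le_eqVlt; apply/orP; left; apply/eqP; ring.
have : cvg (x @ \oo).
  apply: cauchy_cvg; apply/cauchy_exP => e e0.
  have eE : (complex.Re e)%:C%C = e by rewrite RRe_real// gtr0_real.
  have [|N NP] := @geo_small K q (complex.Re e) q01; first by rewrite -ltcR eE.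
  exists (x N), N => // m /= Nm; rewrite -ball_normE/= nmE -eE ltcR nmC.
  by rewrite -(subnKC Nm); apply: le_lt_trans (dist _ _) _; exact: NP.
move=> /cvg_ex[/= l /cvgrPdist_lt xl]; exists l => n.
apply/ler_addgt0Pr => e e0.
have [|N _ NP] := xl e%:C%C; first by rewrite ltcR.
have := NP (n + N)%N (leq_addl _ _); rewrite nmE ltcR => h.
apply: le_trans (nm_trans (x (n + N)%N) _ _) _.
by rewrite addrC; apply: lerD (dist _ _) (ltW h).
Qed.

Section Inner.
Context {V : hilbertType R}.
Implicit Types x y z : V.

Lemma innerC x y : inner x y = (inner y x)^*.
Proof. by rewrite hermC expr0 mul1r. Qed.

Lemma innerDl x y z : inner (x + y) z = inner x z + inner y z.
Proof. exact: linearDl. Qed.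
Lemma innerDr x y z : inner z (x + y) = inner z x + inner z y.
Proof. exact: linearDr. Qed.
Lemma innerBl x y z : inner (x - y) z = inner x z - inner y z.
Proof. exact: linearBl. Qed.
Lemma innerBr x y z : inner z (x - y) = inner z x - inner z y.
Proof. exact: linearBr. Qed.
Lemma innerNl x y : inner (- x) y = - inner x y.
Proof. exact: linearNl. Qed.
Lemma innerNr x y : inner x (- y) = - inner x y.
Proof. exact: linearNr. Qed.
Lemma innerZl a x y : inner (a *: x) y = a * inner x y.
Proof. exact: linearZl_LR. Qed.
Lemma innerZr a x y : inner x (a *: y) = a^* * inner x y.
Proof. exact: linearZr_LR. Qed.
Lemma inner0l x : inner 0 x = 0.
Proof. exact: linear0l. Qed.
Lemma inner0r x : inner x 0 = 0.
Proof. exact: linear0r. Qed.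

Lemma inner_nm x : inner x x = (nm x ^+ 2)%:C%C.
Proof. by rewrite inner_normr nmE rmorphXn. Qed.

Lemma inner_eq0 x : inner x x = 0 -> x = 0.
Proof.
rewrite inner_nm => /(@complexI R)/eqP; rewrite expf_eq0/= => /eqP.
exact: nm_eq0.
Qed.

Lemma inner_inj x y : (forall z, inner z x = inner z y) -> x = y.
Proof.
move=> h; apply/subr0_eq/inner_eq0.
by rewrite innerBr h subrr.
Qed.

Lemma inner_injl x y : (forall z, inner x z = inner y z) -> x = y.
Proof. by move=> h; apply: inner_inj => z; rewrite innerC h -innerC. Qed.

Lemma nmD_sqr x y :
  nm (x + y) ^+ 2 = nm x ^+ 2 + nm y ^+ 2 + 2 * complex.Re (inner x y).
Proof.
have e c : c + c^* = (2 * complex.Re c)%:C%C :> R[i].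
  by rewrite rmorphM/= rmorph_nat -addcJ.
apply: (@complexI R); rewrite -inner_nm innerDl !innerDr.
by rewrite (innerC y x) 2!rmorphD/= -e -!inner_nm; ring.
Qed.

Lemma nmB_sqr x y :
  nm (x - y) ^+ 2 = nm x ^+ 2 + nm y ^+ 2 - 2 * complex.Re (inner x y).
Proof. by rewrite nmD_sqr nmN innerNr; case: (inner x y) => ? ? /=; ring. Qed.

Lemma parallelogram x y :
  nm (x + y) ^+ 2 + nm (x - y) ^+ 2 = 2 * (nm x ^+ 2 + nm y ^+ 2).
Proof. by rewrite nmD_sqr nmB_sqr; ring. Qed.

Lemma cauchy_schwarz x y : nm (inner x y) <= nm x * nm y.
Proof.
have [y0|y0] := eqVneq (nm y) 0.
  by rewrite (nm_eq0 y0) inner0r !nm0 mulr0.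
have {}y0 : 0 < nm y by rewrite lt_def y0 nm_ge0.
set c := inner x y.
have cc : c^* * c = (nm c ^+ 2)%:C%C by rewrite rmorphXn/= -nmE mulrC normCK.
(* Up to the factor [nm y ^+ 2] this vector is the component of [x] orthogonal to [y]. *)
have := sqr_ge0 (nm ((nm y ^+ 2)%:C%C *: x - c *: y)).
rewrite nmB_sqr innerZl innerZr !nmZ nmr ger0_norm ?sqr_ge0// -/c cc -rmorphM/=.
have -> : (nm y ^+ 2 * nm x) ^+ 2 + (nm c * nm y) ^+ 2 -
   2 * (nm y ^+ 2 * nm c ^+ 2) =
   nm y ^+ 2 * ((nm x * nm y) ^+ 2 - nm c ^+ 2) by ring.
rewrite pmulr_rge0 ?exprn_gt0// subr_ge0.
by rewrite ler_pXn2r ?nnegrE ?mulr_ge0 ?nm_ge0.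
Qed.

End Inner.

(* By [adjp_bounded] such a pair consists of bounded operators, so that carrying
   the adjoint along replaces boundedness estimates. *)
Definition adjp {V W : hilbertType R} (A : V -> W) (B : W -> V) :=
  forall x y, inner (A x) y = inner x (B y).

Lemma adjp_sym {V W : hilbertType R} (A : V -> W) (B : W -> V) :
  adjp A B -> adjp B A.
Proof. by move=> AB x y; rewrite innerC -AB -innerC. Qed.

Lemma adjp_linear {V W : hilbertType R} (A : V -> W) (B : W -> V) :
  adjp A B -> linear A.
Proof.
move=> AB a x y; apply: inner_injl => z.
by rewrite AB !innerDl !innerZl !AB.
Qed.

Section Linear.
Context {V W : lmodType R[i]} {A : V -> W} (lA : linear A).

Let A' : {linear V -> W} := HB.pack A (GRing.isLinear.Build _ _ _ _ _ lA).

Lemma linD x y : A (x + y) = A x + A y.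
Proof. exact: (linearD A'). Qed.
Lemma linB x y : A (x - y) = A x - A y.
Proof. exact: (linearB A'). Qed.
Lemma linN x : A (- x) = - A x.
Proof. exact: (linearN A'). Qed.
Lemma lin0 : A 0 = 0.
Proof. exact: (linear0 A'). Qed.
Lemma linZ a x : A (a *: x) = a *: A x.
Proof. exact: (linearZ_LR A'). Qed.
End Linear.

Definition cl {V : normedModType R[i]} (S : set V) : set V :=
  [set x | forall e : R, 0 < e -> exists2 y, S y & nm (x - y) < e].

Section Projection.
Context {V : hilbertType R} {M : set V} (sM : lin_subspace M).

Lemma subspD x y : M x -> M y -> M (x + y).
Proof. by move=> Mx My; rewrite -[x]scale1r; apply: sM.2. Qed.

Lemma subspZ a x : M x -> M (a *: x).
Proof. by move=> Mx; rewrite -[_ *: _]addr0; apply: sM.2 => //; exact: sM.1. Qed.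

Lemma subspN x : M x -> M (- x).
Proof. by rewrite -scaleN1r; exact: subspZ. Qed.

Lemma subspB x y : M x -> M y -> M (x - y).
Proof. by move=> Mx My; apply: subspD => //; exact: subspN. Qed.

Lemma minimizer_ortho x p : (forall m, M m -> nm (x - p) <= nm (x - p - m)) ->
  Defs.ortho M (x - p).
Proof.
move: (x - p) => r rP m Mm.
have [->|m0] := eqVneq m 0; first by rewrite inner0l.
have nm0 : 0 < nm m.
  by rewrite lt_def nm_ge0 andbT; apply: contra m0 => /eqP/nm_eq0->.
set c := inner m r.
(* With this coefficient [t *: m] is the orthogonal projection of [r] onto the line of [m], the best
   competitor. *)
pose t := (nm m ^- 2)%:C%C * c^*.
have := rP _ (subspZ t Mm).
rewrite -(@ler_pXn2r _ 2) ?nnegrE ?nm_ge0// nmB_sqr.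
rewrite innerZr innerC -/c /t rmorphM/= conjCK nmZ nmM nm_conj.
have -> : ((nm m ^- 2)%:C%C)^* = (nm m ^- 2)%:C%C :> R[i] by exact: conjc_real.
have cc : c * c^* = (nm c ^+ 2)%:C%C by rewrite rmorphXn/= -nmE normCK.
rewrite -(mulrA _ c) cc -rmorphM/= nmr ger0_norm; last by rewrite invr_ge0 sqr_ge0.
have -> : (nm m ^- 2 * nm c * nm m) ^+ 2 = nm m ^- 2 * nm c ^+ 2.
  by field; rewrite gt_eqF.
rewrite -addrA lerDl; set d := nm m ^- 2 * _.
have -> : d - 2 * d = - d by ring.
rewrite oppr_ge0 /d pmulr_rle0 ?invr_gt0 ?exprn_gt0// => c0.
apply: nm_eq0; apply/eqP; rewrite -sqrf_eq0.
by rewrite eq_le c0 sqr_ge0.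
Qed.

(** A minimizing sequence for the distance to [M] is Cauchy by the parallelogram law. As [M] need
    not be closed, the foot [p] is only found in [cl M]; applied to the domain of an adjoint this
    detects density. *)
Lemma proj_cl x : exists2 p, cl M p & Defs.ortho M (x - p).
Proof.
pose S := [set nm (x - m) | m in M].
have S0 : has_inf S.
  split; first by exists (nm (x - 0)), 0 => //; exact: sM.1.
  by exists 0 => _ [m _ <-]; exact: nm_ge0.
pose d := inf S.
have dP m : M m -> d <= nm (x - m).
  by move=> Mm; apply: ge_inf; [exact: S0.2|exists m].
have d0 : 0 <= d by apply: lb_le_inf S0.1 _ => _ [m _ <-]; exact: nm_ge0.
(* An excess of [4^-n] in the squared distance keeps consecutive points at most [2 * 2^-n] apart. *)
have ex n : exists m, M m /\ nm (x - m) ^+ 2 <= d ^+ 2 + (2^-1 ^+ 2) ^+ n.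
  pose e := Num.sqrt (d ^+ 2 + (2^-1 ^+ 2) ^+ n) - d.
  have e0 : 0 < e.
    rewrite subr_gt0 -{1}(ger0_norm d0) -sqrtr_sqr ltr_sqrt ?ltrDl.
      by rewrite !exprn_gt0.
    by rewrite ltr_wpDl ?sqr_ge0// !exprn_gt0.
  have [_ [m Mm <-] me] := inf_adherent e0 S0.
  exists m; split => //; move: me; rewrite -/d /e (addrC d) subrK => /ltW.
  rewrite -(@ler_pXn2r _ 2) ?nnegrE ?nm_ge0 ?sqrtr_ge0// sqr_sqrtr//.
  by rewrite addr_ge0 ?sqr_ge0// !exprn_ge0.
have [y yP] := choice ex.
have half01 : 0 <= (2^-1 : R) < 1 by lra.
have [p pP] : exists p, forall n, nm (p - y n) <= 2 / (1 - 2^-1) * 2^-1 ^+ n.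
  apply: geo_lim => // n.
  have [My yn] := yP n; have [MyS ynS] := yP n.+1.
  rewrite -(@ler_pXn2r _ 2) ?nnegrE ?nm_ge0 ?mulr_ge0 ?exprn_ge0//.
  have := parallelogram (x - y n) (x - y n.+1).
  have -> : x - y n - (x - y n.+1) = y n.+1 - y n.
    by rewrite opprB addrC addrA subrK.
  have : d <= nm (x - (2^-1 : R[i]) *: (y n + y n.+1)).
    by apply: dP; apply: subspZ; exact: subspD.
  have -> : x - y n + (x - y n.+1) =
      2 *: (x - (2^-1 : R[i]) *: (y n + y n.+1)).
    rewrite scalerBr scalerA divff// scale1r scaler_nat.
    by rewrite addrACA -opprD.
  rewrite nmZ nm2.
  set a := nm (x - _); set b := nm (_ - _) ^+ 2 => da.
  have da2 : d ^+ 2 <= a ^+ 2 by rewrite ler_pXn2r ?nnegrE ?nm_ge0.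
  rewrite !exprMn -exprM mulnC exprM; move: yn ynS.
  rewrite [_ ^+ n.+1]exprS; set q := _ ^+ n => yn ynS.
  have q0 : 0 <= q by rewrite /q !exprn_ge0.
  set u := nm (x - y n) ^+ 2 in yn *.
  set v := nm (x - y n.+1) ^+ 2 in ynS *.
  lra.
exists p.
  move=> e e0; have [n nP] := geo_small (2 / (1 - 2^-1)) half01 e0.
  by exists (y n); [exact: (yP n).1|exact: le_lt_trans (pP n) (nP n _)].
have pd : nm (x - p) <= d.
  apply/ler_addgt0Pr => e e0.
  have [n nP] := geo_small (2 / (1 - 2^-1) + 1) half01 e0.
  have [My yn] := yP n.
  have xy : nm (x - y n) <= d + 2^-1 ^+ n.
    rewrite -(@ler_pXn2r _ 2) ?nnegrE ?nm_ge0 ?addr_ge0 ?exprn_ge0//.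
    apply: le_trans yn _; rewrite sqrrD -addrA -exprM mulnC exprM lerD2l lerDr.
    by rewrite mulrn_wge0// mulr_ge0// exprn_ge0.
  apply: le_trans (nm_trans (y n) _ _) _; rewrite (nmC (y n) p).
  apply: le_trans (lerD xy (pP n)) _; rewrite -addrA lerD2l.
  by have := nP n (leqnn n); set q := _ ^+ n; lra.
apply: minimizer_ortho => m Mm.
apply: le_trans pd _; apply/ler_addgt0Pr => e e0.
have [n nP] := geo_small (2 / (1 - 2^-1)) half01 e0.
have [My _] := yP n.
apply: le_trans (dP _ (subspD My Mm)) _.
apply: le_trans (nm_trans (p + m) _ _) _.
have -> : p + m - (y n + m) = p - y n by rewrite opprD addrACA subrr addr0.
rewrite opprD addrA lerD2l.
by apply/ltW/(le_lt_trans (pP n))/nP.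
Qed.

End Projection.
End RealNorm.

(** * Riesz, uniform boundedness, closed graph *)

Section FunctionalAnalysis.
Context {R : realType}.

(** The representing vector is a multiple of the component [r] of some [x0] orthogonal to the kernel
    [M] of [f]. Boundedness of [f] gives [f p = 0] although [p] is only a limit of points of [M]. *)
Lemma riesz {V : hilbertType R} (f : V -> R[i]) (K : R) :
  (forall a x y, f (a *: x + y) = a * f x + f y) ->
  (forall x, nm (f x) <= K * nm x) -> exists z, forall x, f x = inner x z.
Proof.
move=> lf fK.
have f0 : f 0 = 0.
  by have := lf (-1) 0 0; rewrite scaler0 addr0 mulN1r addNr.
have [fz|/existsNP[x0 fx0]] := pselect (forall x, f x = 0).
  by exists 0 => x; rewrite inner0r fz.
pose M := [set x | f x = 0].
have sM : lin_subspace M.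
  by split=> // a x y Mx My; rewrite /M/= lf Mx My mulr0 addr0.
have [p clp po] := proj_cl sM x0.
have fB x y : f (x - y) = f x - f y.
  by rewrite addrC -scaleN1r lf mulN1r addrC.
have fp : f p = 0.
  apply/nm_eq0/le_anti; rewrite nm_ge0 andbT; apply/ler_addgt0Pr => e e0.
  have K1 : 0 < `|K| + 1 by rewrite ltr_wpDl.
  have [|y My py] := clp (e / (`|K| + 1)); first by rewrite divr_gt0.
  have -> : f p = f (p - y) by rewrite fB My subr0.
  rewrite add0r (le_trans (fK _))//.
  have : (`|K| + 1) * nm (p - y) <= e.
    by rewrite mulrC -ler_pdivlMr// ltW.
  by apply: le_trans; rewrite ler_wpM2r ?nm_ge0// (le_trans (ler_norm _))// lerDl.
set r := x0 - p in po.
have fr : f r = f x0 by rewrite fB fp subr0.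
have fr0 : f r != 0 by rewrite fr; apply/eqP.
have rr0 : inner r r != 0.
  by apply: contra fr0 => /eqP/inner_eq0->; rewrite f0.
exists ((f r / inner r r)^* *: r) => x.
rewrite innerZr conjCK.
have : M (x - (f x / f r) *: r).
  by rewrite /M/= addrC -scaleNr lf mulNr divfK// addNr.
move=> /po; rewrite innerBl innerZl => /subr0_eq ->.
by field; rewrite fr0.
Qed.

Lemma bounded_adjp {V W : hilbertType R} (A : V -> W) (K : R) :
  linear A -> (forall x, nm (A x) <= K * nm x) -> exists B, adjp A B.
Proof.
move=> lA AK.
have ex y : exists z, forall x, inner (A x) y = inner x z.
  apply: (@riesz _ _ (K * nm y)) => [a u v|x].
    by rewrite lA innerDl innerZl.
  rewrite (le_trans (cauchy_schwarz _ _))// mulrAC ler_wpM2r ?nm_ge0//.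
have [B BP] := choice ex.
by exists B => x y; exact: BP.
Qed.

(* A gliding hump: the library's Baire and Banach-Steinhaus theorems are for
   real scalars. Moving by [3^-n] in the direction of [+- y n] makes
   [|<x, y n>|] large, and the later moves undo at most half of it. *)
Lemma uniform_boundedness {V : hilbertType R} (S : set V) :
  (forall x, exists c : R, forall y, S y -> nm (inner x y) <= c) ->
  exists c : R, forall y, S y -> nm y <= c.
Proof.
move=> Sb; apply: contrapT => nb.
have big (n : nat) : exists y, S y /\ 2 * n%:R * 3 ^+ n < nm y.
  apply: contrapT => h; apply: nb; exists (2 * n%:R * 3 ^+ n) => y Sy.
  by rewrite leNgt; apply/negP => yb; apply: h; exists y.
have [y yP] := choice big.
have y0 n : 0 < nm (y n).
  by apply: le_lt_trans (yP n).2; rewrite !mulr_ge0// exprn_ge0.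
have step (nv : nat * V) : exists v', nm (v' - nv.2) <= 3^-1 ^+ nv.1 /\
    3^-1 ^+ nv.1 * nm (y nv.1) <= nm (inner v' (y nv.1)).
  case: nv => n v /=.
  set t : R := 3^-1 ^+ n; have t0 : 0 < t by rewrite exprn_gt0.
  pose w := (t / nm (y n))%:C%C *: y n.
  have nw : nm w = t.
    by rewrite nmZ nmr ger0_norm ?divr_ge0 ?nm_ge0 ?ltW// divfK// gt_eqF.
  have iw : inner w (y n) = (t * nm (y n))%:C%C.
    rewrite innerZl inner_nm -rmorphM/=; congr (_%:C)%C.
    by rewrite expr2 mulrA divfK// gt_eqF.
  have : nm (inner (v + w) (y n) - inner (v - w) (y n)) = 2 * (t * nm (y n)).
    rewrite -innerBl opprB addrC addrA subrK -mulr2n -scaler_nat innerZl iw.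
    rewrite nmM nmr ger0_norm ?mulr_ge0 ?nm_ge0 ?(ltW t0)//.
    by rewrite nm2.
  have := nmD (inner (v + w) (y n)) (- inner (v - w) (y n)).
  rewrite nmN; case: (leP (t * nm (y n)) (nm (inner (v + w) (y n)))) => h1 h2 h3.
    by exists (v + w); split=> //; rewrite addrAC subrr add0r nw.
  exists (v - w); split; first by rewrite addrAC subrr add0r nmN nw.
  by move: h1 h2 h3; lra.
have [f fP] := choice step.
pose fix x n := if n is m.+1 then f (m, x m) else 0.
have third : 0 <= (3^-1 : R) < 1 by lra.
have [l lP] : exists l, forall n, nm (l - x n) <= 1 / (1 - 3^-1) * 3^-1 ^+ n.
  by apply: geo_lim => // n; rewrite mul1r /=; exact: (fP (n, x n)).1.
have [c cP] := Sb l.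
have lb n : n%:R < nm (inner l (y n)).
  have [Sy yn] := yP n.
  have := (fP (n, x n)).2; rewrite /= -/(x n.+1) => xy.
  have := lP n.+1; rewrite exprS => lx.
  have : nm (inner (l - x n.+1) (y n)) <= 2^-1 * 3^-1 ^+ n * nm (y n).
    apply: le_trans (cauchy_schwarz _ _) _; rewrite ler_wpM2r ?nm_ge0//.
    have -> : 2^-1 = 1 / (1 - 3^-1) * 3^-1 :> R by field; lra.
    by rewrite -mulrA.
  have : nm (inner (x n.+1) (y n)) <=
      nm (inner (l - x n.+1) (y n)) + nm (inner l (y n)).
    have {1}-> : inner (x n.+1) (y n) = inner l (y n) - inner (l - x n.+1) (y n).
      by rewrite innerBl; ring.
    by rewrite addrC (le_trans (nmD _ _))// nmN.
  have : n%:R < 2^-1 * (3^-1 ^+ n * nm (y n)).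
    have <- : 2^-1 * (3^-1 ^+ n * (2 * n%:R * 3 ^+ n)) = n%:R :> R.
      rewrite exprVn; field; rewrite ?expf_neq0//; lra.
    by rewrite ltr_pM2l ?invr_gt0// ltr_pM2l ?exprn_gt0.
  move: xy; rewrite -mulrA; set a := _ ^+ n * _ ; lra.
have [n nc] : exists n, c < n%:R.
  by exists (Num.bound `|c|); apply: le_lt_trans (ler_norm _) (archi_boundP _).
have := lt_trans nc (lb n).
by rewrite ltNge cP//; exact: (yP n).1.
Qed.

(** The Hellinger-Toeplitz theorem: paired with any fixed [w], the images of the unit ball are
    bounded by [nm (B w)], so uniform boundedness applies. *)
Lemma adjp_bounded {V W : hilbertType R} (A : V -> W) (B : W -> V) :
  adjp A B -> exists2 c : R, 0 < c & forall x, nm (A x) <= c * nm x.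
Proof.
move=> AB; have lA := adjp_linear AB.
have [|c cP] := @uniform_boundedness W [set A x | x in [set x | nm x <= 1]].
  move=> w; exists (nm (B w)) => _ [x x1 <-].
  rewrite -(adjp_sym AB) (le_trans (cauchy_schwarz _ _))//.
  by rewrite ler_piMr ?nm_ge0.
exists (`|c| + 1); first by rewrite ltr_wpDl.
move=> x; have [/nm_eq0 ->|x0] := eqVneq (nm x) 0.
  by rewrite (lin0 lA) !nm0 mulr0.
have x0' : 0 < nm x by rewrite lt_def x0 nm_ge0.
have nV : nm (nm x)^-1%:C%C = (nm x)^-1 by rewrite nmr ger0_norm ?invr_ge0 ?nm_ge0.
have : nm (A ((nm x)^-1%:C%C *: x)) <= c.
  by apply: cP; exists ((nm x)^-1%:C%C *: x) => //=; rewrite nmZ nV mulVf.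
rewrite (linZ lA) nmZ nV mulrC ler_pdivrMr// => /le_trans; apply.
by rewrite ler_wpM2r ?nm_ge0// (le_trans (ler_norm _))// lerDl.
Qed.

(* Projecting [(0, v)] onto the graph shows that only [0] is orthogonal to the
   domain [D] of the adjoint; the adjoint is bounded on [D] by uniform
   boundedness, hence so is [A]. *)
Lemma closed_graph {V W : hilbertType R} (A : V -> W) : linear A ->
  (forall x y, (forall e : R, 0 < e ->
      exists x', nm (x - x') < e /\ nm (y - A x') < e) -> y = A x) ->
  exists B, adjp A B.
Proof.
move=> lA gA.
pose D := [set z | exists w, forall x, inner (A x) z = inner x w].
have sD : lin_subspace D.
  split; first by exists 0 => x; rewrite !inner0r.
  move=> a z z' [w zw] [w' zw']; exists (a *: w + w') => x.
  by rewrite !innerDr !innerZr zw zw'.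
pose G : set (hsum V W) := [set (x, A x) | x in setT].
have sG : lin_subspace G.
  split; first by exists 0 => //; rewrite (lin0 lA).
  move=> a _ _ [x _ <-] [y _ <-]; exists (a *: x + y) => //.
  by rewrite lA.
have nm1 (u : hsum V W) : nm u ^+ 2 = nm u.1 ^+ 2 + nm u.2 ^+ 2.
  apply: (@complexI R); rewrite -inner_nm rmorphD/= -!inner_nm; exact: erefl.
have le1 (u : hsum V W) : nm u.1 <= nm u.
  by rewrite -(@ler_pXn2r _ 2) ?nnegrE ?nm_ge0// nm1 lerDl sqr_ge0.
have le2 (u : hsum V W) : nm u.2 <= nm u.
  by rewrite -(@ler_pXn2r _ 2) ?nnegrE ?nm_ge0// nm1 lerDr sqr_ge0.
have Dperp v : Defs.ortho D v -> v = 0.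
  move=> Dv; have [p clp po] := proj_cl sG ((0, v) : hsum V W).
  have pE : p.2 = A p.1.
    apply: gA => e e0; have [_ [x _ <-] px] := clp _ e0.
    exists x; split; first exact: le_lt_trans (le1 (p - _)) px.
    exact: le_lt_trans (le2 (p - _)) px.
  have orth x : inner x (- p.1) + inner (A x) (v - p.2) = 0.
    by have := po (x, A x); rewrite -[- p.1]add0r; apply; exists x.
  have Dv2 : D (v - p.2).
    exists p.1 => x; have /eqP := orth x.
    by rewrite innerNr addrC subr_eq0 => /eqP.
  have h := Dv _ Dv2.
  have : nm p.1 ^+ 2 + nm (v - p.2) ^+ 2 = 0.
    apply: (@complexI R); rewrite rmorphD/= -!inner_nm innerBr h sub0r.
    have := orth p.1; rewrite innerNr -pE => /eqP; rewrite addrC subr_eq0 => /eqP.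
    move=> h2; rewrite (innerC (v - p.2)) h2 -innerC.
    by rewrite subrr.
  move/eqP; rewrite paddr_eq0 ?sqr_ge0// !expf_eq0/= => /andP[/eqP/nm_eq0 p1].
  by move=> /eqP/nm_eq0/subr0_eq ->; rewrite pE p1 (lin0 lA).
have dD v : cl D v.
  have [p clp /Dperp/subr0_eq ->] := proj_cl sD v; exact: clp.
have [c cP] : exists c : R, forall z, D z -> nm z <= 1 -> forall w,
    (forall x, inner (A x) z = inner x w) -> nm w <= c.
  pose S := [set w | exists z, nm z <= 1 /\ forall x, inner (A x) z = inner x w].
  have [|c cP] := @uniform_boundedness _ S.
    move=> x; exists (nm (A x)) => w [z [z1 zw]].
    rewrite -zw (le_trans (cauchy_schwarz _ _))//.
    by rewrite ler_piMr ?nm_ge0.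
  by exists c => z _ z1 w zw; apply: cP; exists z.
pose K := `|c| + 1; have K0 : 0 < K by rewrite ltr_wpDl.
have Dle z x : D z -> nm (inner (A x) z) <= K * nm x * nm z.
  move=> Dz; have [/nm_eq0 ->|z0] := eqVneq (nm z) 0.
    by rewrite inner0r !nm0 mulr0.
  have z0' : 0 < nm z by rewrite lt_def z0 nm_ge0.
  have [w zw] := Dz.
  have nV : nm (nm z)^-1%:C%C = (nm z)^-1 by rewrite nmr ger0_norm ?invr_ge0 ?nm_ge0.
  have wc : nm ((nm z)^-1%:C%C *: w) <= c.
    apply: (cP ((nm z)^-1%:C%C *: z)).
    - exact: (subspZ sD).
    - by rewrite nmZ nV mulVf.
    - by move=> u; rewrite !innerZr zw.
  rewrite zw (le_trans (cauchy_schwarz _ _))// (mulrC K) -mulrA ler_wpM2l ?nm_ge0//.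
  move: wc; rewrite nmZ nV mulrC ler_pdivrMr// => /le_trans; apply.
  by rewrite ler_wpM2r ?nm_ge0// (le_trans (ler_norm _))// lerDl.
apply: (@bounded_adjp _ _ _ K) => // x.
have [/eqP|Ax0] := eqVneq (nm (A x)) 0.
  by move=> /eqP ->; rewrite mulr_ge0 ?nm_ge0 ?(ltW K0).
have {}Ax0 : 0 < nm (A x) by rewrite lt_def Ax0 nm_ge0.
rewrite -(@ler_pM2r _ (nm (A x)))//.
apply/ler_addgt0Pr => e e0.
(* [Dle] passes from [D] to [A x] by density; [d] collects the coefficients of the approximation
   error [e / d], and the 1 keeps it positive. *)
pose d := K * nm x + nm (A x) + 1.
have Kx : 0 <= K * nm x by rewrite mulr_ge0 ?nm_ge0 ?(ltW K0).
have d0 : 0 < d by rewrite ltr_wpDl// addr_ge0 ?nm_ge0.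
have [|z Dz Az] := dD (A x) (e / d); first by rewrite divr_gt0.
have : nm (inner (A x) (A x)) <= K * nm x * nm z + nm (A x) * (e / d).
  rewrite -[X in inner _ X](subrK z) addrC innerDr (le_trans (nmD _ _))//.
  rewrite lerD ?Dle// (le_trans (cauchy_schwarz _ _))//.
  by rewrite ler_wpM2l ?nm_ge0 ?ltW.
rewrite inner_nm nmr ger0_norm ?sqr_ge0// expr2 => /le_trans; apply.
have zA : nm z <= nm (A x) + e / d.
  by rewrite -{1}(subrK (A x) z) addrC (le_trans (nmD _ _))// lerD2l nmC ltW.
apply: (@le_trans _ _ (K * nm x * (nm (A x) + e / d) + nm (A x) * (e / d))).
  by rewrite lerD2r ler_wpM2l.
rewrite mulrDr -addrA lerD2l -mulrDl mulrA ler_pdivrMr// mulrC.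
by rewrite ler_wpM2l ?(ltW e0)// /d lerDl.
Qed.

Lemma neumann {V : completeNormedModType R[i]} (B : V -> V) (r : R) :
  linear B -> 0 <= r < 1 -> (forall x, nm (B x) <= r * nm x) ->
  forall y, exists x, x - B x = y.
Proof.
move=> lB r01 Br y.
pose fix x n := if n is m.+1 then y + B (x m) else 0.
have [|l lP] := @geo_lim _ _ x (nm y) r (nm_ge0 _) r01.
  elim=> [|n ih]; first by rewrite /= (lin0 lB) addr0 subr0 expr0 mulr1.
  have -> : x n.+2 - x n.+1 = B (x n.+1 - x n).
    by rewrite (linB lB)/= opprD addrACA subrr add0r.
  apply: le_trans (Br _) _; rewrite exprS mulrCA ler_wpM2l//.
  by case/andP: r01.
exists l; apply/subr0_eq/nm_eq0/le_anti; rewrite nm_ge0 andbT.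
set K := nm y / (1 - r) in lP.
apply: (@geo_le0 _ (K * r + r * K) r) => // n.
have -> : l - B l - y = (l - x n.+1) - B (l - x n).
  by rewrite (linB lB)/= opprB opprD (addrA l) subrKA addrAC.
apply: le_trans (nmD _ _) _; rewrite nmN mulrDl; apply: lerD.
  by rewrite -mulrA -exprS.
apply: le_trans (Br _) _; rewrite -mulrA ler_wpM2l//.
by case/andP: r01.
Qed.

End FunctionalAnalysis.

(** * Inverse square roots of uniformly positive operators *)

Section SquareRoot.
Context {R : realType}.

Lemma nm2V : nm (2^-1 : R[i]) = 2^-1.
Proof.
have := @nmM R 2 2^-1; rewrite nm2 divff// [nm 1]/nm normr1 => h.
by apply: (mulfI (x := 2)) => //; rewrite -h divff.
Qed.

(* [1 - S] squares to [1 - B] iff [S = (B + S^2) / 2]; the iteration contracts on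
   the operators of norm at most [r]. *)
Lemma sqrt_1_sub {V : hilbertType R} (B : V -> V) (r : R) :
  adjp B B -> 0 <= r < 1 -> (forall x, nm (B x) <= r * nm x) ->
  exists2 T, adjp T T & forall x, T (T x) = x - B x.
Proof.
move=> BB r01 Br; have /andP[r0 r1] := r01.
pose Z := fix Z (n : nat) (x : V) {struct n} : V :=
  if n is m.+1 then 2^-1 *: (B x + Z m (Z m x)) else 0.
have ZZ n : adjp (Z n) (Z n).
  elim: n => [|n ih] x y /=; first by rewrite inner0l inner0r.
  rewrite innerZl innerZr innerDl innerDr BB !ih; congr (_ * _).
  by rewrite fmorphV rmorph_nat.
have lZ n : linear (Z n) by exact: adjp_linear (ZZ n).
have Zr n x : nm (Z n x) <= r * nm x.
  elim: n x => [|n ih] x /=; first by rewrite nm0 mulr_ge0 ?nm_ge0.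
  rewrite nmZ nm2V ler_pdivrMl// (le_trans (nmD _ _))//.
  have : nm (Z n (Z n x)) <= r * nm x.
    apply: le_trans (ih _) _; apply: le_trans (ler_wpM2l r0 (ih _)) _.
    by rewrite mulrA ler_wpM2r ?nm_ge0// ler_piMr// ltW.
  by have := Br x; lra.
have dZ n x : nm (Z n.+1 x - Z n x) <= r * nm x * r ^+ n.
  elim: n x => [|n ih] x.
    by rewrite expr0 mulr1 subr0; exact: (Zr 1%N).
  (* This is [a^2 - b^2 = a (a - b) + (a - b) b], which holds whether or not the iterates
     commute. *)
  have -> : Z n.+2 x - Z n.+1 x = 2^-1 *:
      (Z n.+1 (Z n.+1 x - Z n x) + (Z n.+1 (Z n x) - Z n (Z n x))).
    by rewrite (linB (lZ n.+1)) subrKA -scalerBr opprD addrACA subrr add0r.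
  rewrite nmZ nm2V ler_pdivrMl// (le_trans (nmD _ _))//.
  rewrite -[X in _ <= X * _]/(1 + 1) mulrDl mul1r exprS lerD//.
    apply: le_trans (Zr _ _) _; apply: le_trans (ler_wpM2l r0 (ih _)) _.
    by rewrite mulrCA.
  apply: le_trans (ih _) _.
  rewrite mulrA ler_wpM2r ?exprn_ge0// -mulrA ler_wpM2l//.
  by rewrite mulrC; exact: Zr.
pose K := r / (1 - r).
have K0 : 0 <= K by rewrite divr_ge0// subr_ge0 ltW.
have ex x : exists l, forall n, nm (l - Z n x) <= K * nm x * r ^+ n.
  have [l lP] := geo_lim (mulr_ge0 r0 (nm_ge0 x)) r01 (dZ^~ x).
  by exists l => n; rewrite /K [_ / _ * nm x]mulrAC.
have [S SP] := choice ex.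
have SS : adjp S S.
  move=> x y; apply/subr0_eq/nm_eq0/le_anti; rewrite nm_ge0 andbT.
  apply: (@geo_le0 _ (K * nm x * nm y + nm x * (K * nm y)) r) => // n.
  have -> : inner (S x) y - inner x (S y) =
     inner (S x - Z n x) y - inner x (S y - Z n y).
    by rewrite innerBl innerBr ZZ; ring.
  rewrite (le_trans (nmD _ _))// nmN mulrDl lerD//.
    rewrite (le_trans (cauchy_schwarz _ _))// mulrAC ler_wpM2r ?nm_ge0//.
  by rewrite (le_trans (cauchy_schwarz _ _))// -mulrA ler_wpM2l ?nm_ge0.
have lS := adjp_linear SS.
have SE x : S x = 2^-1 *: (B x + S (S x)).
  apply/subr0_eq/nm_eq0/le_anti; rewrite nm_ge0 andbT.
  pose C := K * nm x + (r * (K * nm x) + K * nm (S x)).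
  apply: (@geo_le0 _ C r) => // n.
  have -> : S x - 2^-1 *: (B x + S (S x)) = (S x - Z n.+1 x) +
      2^-1 *: (Z n (Z n x - S x) + (Z n (S x) - S (S x))).
    rewrite (linB (lZ n)) subrKA /= !scalerBr !scalerDr.
    by rewrite !opprD !addrA subrK.
  rewrite (le_trans (nmD _ _))// /C mulrDl lerD//.
    apply: le_trans (SP x n.+1) _; apply: ler_wpM2l; first by rewrite mulr_ge0 ?nm_ge0.
    by rewrite exprS; apply: ler_piMl; rewrite ?exprn_ge0// ltW.
  have h : nm (Z n (Z n x - S x) + (Z n (S x) - S (S x))) <=
      (r * (K * nm x) + K * nm (S x)) * r ^+ n.
    rewrite (le_trans (nmD _ _))// mulrDl lerD//; last by rewrite nmC.
    by rewrite (le_trans (Zr _ _))// -mulrA ler_wpM2l// nmC.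
  rewrite nmZ nm2V; have := nm_ge0 (Z n (Z n x - S x) + (Z n (S x) - S (S x))).
  by move: h; lra.
exists (fun x => x - S x) => [x y|x].
  by rewrite innerBl innerBr SS.
rewrite (linB lS).
have -> : B x = S x + S x - S (S x).
  have {1 2}-> := SE x; rewrite -scalerDl.
  have -> : 2^-1 + 2^-1 = 1 :> R[i] by rewrite -mulr2n -[_ *+ 2]mulr_natr mulVf.
  by rewrite scale1r addrK.
by rewrite !opprD !addrA.
Qed.

(* By polarization [4 Re <B x, y> <= r |x + y|^2 <= 4 r |x|^2] when [|y| = |x|];
   take [y] in the direction of [B x]. *)
Lemma pos_contraction {V : hilbertType R} (B : V -> V) (r : R) :
  adjp B B -> (forall x, 0 <= complex.Re (inner (B x) x) <= r * nm x ^+ 2) ->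
  forall x, nm (B x) <= r * nm x.
Proof.
move=> BB Br x; have lB := adjp_linear BB.
have [/nm_eq0 ->|x0] := eqVneq (nm x) 0.
  by rewrite (lin0 lB) !nm0 mulr0.
have {}x0 : 0 < nm x by rewrite lt_def x0 nm_ge0.
have [Bx0|Bx0] := eqVneq (nm (B x)) 0.
  have /andP[h1 h2] := Br x; have := le_trans h1 h2.
  by rewrite Bx0 pmulr_lge0 ?exprn_gt0// => r0; rewrite mulr_ge0// ltW.
have {}Bx0 : 0 < nm (B x) by rewrite lt_def Bx0 nm_ge0.
pose y := (nm x / nm (B x))%:C%C *: B x.
have ny : nm y = nm x.
  by rewrite nmZ nmr ger0_norm ?divr_ge0 ?nm_ge0// divfK// gt_eqF.
have Bxy : complex.Re (inner (B x) y) = nm x * nm (B x).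
  rewrite innerZr inner_nm.
  have -> : ((nm x / nm (B x))%:C%C)^* = (nm x / nm (B x))%:C%C :> R[i].
    exact: conjc_real.
  by rewrite -rmorphM/= expr2 mulrA divfK// gt_eqF.
have /andP[_ h1] := Br (x + y); have /andP[h2 _] := Br (x - y).
have r0 : 0 <= r.
  have /andP[h3 h4] := Br x; have := le_trans h3 h4.
  by rewrite pmulr_lge0 ?exprn_gt0.
have h3 : r * nm (x + y) ^+ 2 <= r * (4 * nm x ^+ 2).
  rewrite ler_wpM2l//; have := parallelogram x y; rewrite ny.
  by have := sqr_ge0 (nm (x - y)); lra.
have pol : complex.Re (inner (B (x + y)) (x + y)) -
    complex.Re (inner (B (x - y)) (x - y)) = 4 * complex.Re (inner (B x) y).
  rewrite (linD lB) (linB lB) !(innerBl, innerBr, innerDl, innerDr).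
  have -> : inner (B y) x = (inner (B x) y)^*%C by rewrite BB innerC.
  case: (inner (B x) y) => a b; case: (inner _ _) => c d; case: (inner _ _) => e f.
  by rewrite /=; ring.
rewrite -(@ler_pM2l _ (nm x))// -Bxy.
have : 4 * complex.Re (inner (B x) y) <= r * (4 * nm x ^+ 2).
  by rewrite -pol; lra.
by rewrite expr2 (mulrCA (nm x)); lra.
Qed.

(** For [c] large, [B = 1 - A / c] is positive of norm at most [1 - e / c < 1], so [A / c] has a
    self-adjoint root [T]. Coercivity makes [T] injective, the Neumann series makes [A] and hence
    [T] surjective, and [S] is [T^-1 / sqrt c]. *)
Lemma pos_inv_sqrt {V : hilbertType R} (A : V -> V) (e : R) :
  0 < e -> adjp A A ->
  (forall x, e * nm x ^+ 2 <= complex.Re (inner (A x) x)) ->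
  exists2 S, adjp S S & [/\ forall x, S (A (S x)) = x, forall x, A (S (S x)) = x
    & forall x, S (S (A x)) = x].
Proof.
move=> e0 AA Ae; have lA := adjp_linear AA.
have [c0 c0p Ac0] := adjp_bounded AA.
(* Adding [e] to the bound [c0] gives [e / c <= 1], that is [0 <= r]. *)
pose c := c0 + e; have c_gt0 : 0 < c by rewrite addr_gt0.
have Ac x : nm (A x) <= c * nm x.
  by rewrite (le_trans (Ac0 x))// ler_wpM2r ?nm_ge0// lerDl ltW.
pose ci : R[i] := (c^-1)%:C%C.
have ciJ : ci^* = ci by exact: conjc_real.
pose B x := x - ci *: A x.
have BB : adjp B B.
  by move=> x y; rewrite /B innerBl innerBr innerZl innerZr ciJ AA.
pose r := 1 - e / c.
have ec : e / c <= 1 by rewrite ler_pdivrMr// mul1r lerDr ltW.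
have r01 : 0 <= r < 1.
  by rewrite subr_ge0 ec ltrBlDr ltrDl divr_gt0.
have Br := @pos_contraction _ B r BB.
have {}Br x : nm (B x) <= r * nm x.
  apply: Br => {}x; rewrite /B innerBl innerZl inner_nm.
  have -> : complex.Re ((nm x ^+ 2)%:C%C - ci * inner (A x) x) =
      nm x ^+ 2 - c^-1 * complex.Re (inner (A x) x).
    by case: (inner _ _) => a b /=; ring.
  have h1 : complex.Re (inner (A x) x) <= c * nm x ^+ 2.
    rewrite (le_trans (Re_le_nm _))// (le_trans (cauchy_schwarz _ _))//.
    by rewrite expr2 mulrA ler_wpM2r ?nm_ge0.
  rewrite subr_ge0 ler_pdivrMl// h1/= /r mulrBl mul1r lerB// -mulrA.
  by rewrite mulrCA ler_pM2l ?invr_gt0.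
have [T TT TB] := sqrt_1_sub BB r01 Br.
have {}TB x : T (T x) = ci *: A x by rewrite TB /B opprB addrC subrK.
have lT := adjp_linear TT.
have Tinj x y : T x = T y -> x = y.
  move=> xy; apply/subr0_eq/nm_eq0.
  have : A (x - y) = 0.
    have := TB (x - y); rewrite (linB lT) xy subrr (lin0 lT) => /esym/eqP.
    by rewrite scaler_eq0 (inj_eq (@complexI _) _ 0) invr_eq0 gt_eqF//= => /eqP.
  have := Ae (x - y) => /[swap] ->; rewrite inner0l => h.
  apply/eqP; rewrite -sqrf_eq0 eq_le sqr_ge0 andbT.
  by move: h; rewrite pmulr_rle0.
have Tsurj y : exists x, T x = y.
  have [x xy] := neumann (adjp_linear BB) r01 Br y.
  by exists (T x); rewrite TB -xy /B opprB addrC subrK.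
have [S0 S0P] := choice Tsurj.
have S0T x : S0 (T x) = x by apply: Tinj; rewrite S0P.
have S0S : adjp S0 S0.
  by move=> x y; rewrite -{1}(S0P y) -TT S0P.
have AT x : A x = c%:C%C *: T (T x).
  by rewrite TB scalerA -rmorphM/= divff ?scale1r// gt_eqF.
pose s : R[i] := (Num.sqrt c)^-1%:C%C.
have sJ : s^* = s by exact: conjc_real.
have ss : s * s * c%:C%C = 1.
  rewrite -!rmorphM/= -expr2 exprVn sqr_sqrtr ?ltW//.
  by rewrite mulVf ?gt_eqF// rmorph1.
have lS := adjp_linear S0S.
exists (fun x => s *: S0 x) => [x y|].
  by rewrite innerZl innerZr sJ S0S.
split=> x.
- rewrite AT !(linZ lT) S0P !(linZ lS) S0T !scalerA.
  by rewrite (mulrC _ s) mulrA ss scale1r.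
- rewrite AT (linZ lS) !(linZ lT) !S0P !scalerA.
  by rewrite mulrC ss scale1r.
- by rewrite AT !(linZ lS) !S0T !scalerA mulrA ss scale1r.
Qed.

End SquareRoot.

(** * Indefinite factorization *)

Section Indefinite.
Context {R : realType} {X : hilbertType R}.

Lemma inner_hsum (V W : hilbertType R) (u v : hsum V W) :
  inner u v = inner u.1 v.1 + inner u.2 v.2.
Proof. by []. Qed.

Lemma adjp_comp (U V W : hilbertType R) (A : U -> V) As (B : V -> W) Bs :
  adjp A As -> adjp B Bs -> adjp (B \o A) (As \o Bs).
Proof. by move=> h k x y /=; rewrite k h. Qed.

Lemma J1_adjp : adjp (J1 : hsum X X -> hsum X X) J1.
Proof. by move=> x y; rewrite !inner_hsum /J1/= addrC. Qed.

(* [N] is uniformly positive on the graph of [G] and [N^-1] uniformly negative on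
   its orthogonal complement, so the two subspaces [graph G] and
   [N^-1 (graph G)^perp] split the form [<N u, u>] into a positive and a negative
   part; normalizing them by inverse square roots gives [diag (1, -1)], and
   [cay] turns that into [J1]. *)
Lemma indefinite_factor (G : X -> X) (N Ni : hsum X X -> hsum X X) (e : R) :
  0 < e -> adjp G G -> adjp N N -> cancel N Ni -> cancel Ni N ->
  (forall p, e * nm p ^+ 2 <= complex.Re (inner (N (p, G p)) (p, G p))) ->
  (forall q, e * nm q ^+ 2 <= - complex.Re (inner (Ni (- G q, q)) (- G q, q))) ->
  exists W Ws : hsum X X -> hsum X X, [/\ adjp W Ws,
    forall x, Ws (N (W x)) = J1 x & forall x, W (J1 (Ws x)) = Ni x].
Proof.
move=> e0 GG NN NK NiK Npos Nneg.
have NiNi : adjp Ni Ni by move=> x y; rewrite -{1}(NiK y) -NN NiK.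
have lN := adjp_linear NN; have lNi := adjp_linear NiNi.
have lG := adjp_linear GG.
pose ip (p : X) : hsum X X := (p, G p).
pose ips (u : hsum X X) := u.1 + G u.2.
pose im (q : X) : hsum X X := (- G q, q).
pose ims (u : hsum X X) := u.2 - G u.1.
have ipA : adjp ip ips.
  by move=> x y; rewrite inner_hsum /ip /ips/= innerDr GG.
have imA : adjp im ims.
  by move=> x y; rewrite inner_hsum /im /ims/= innerBr innerNl GG addrC.
have ipsim q : ips (im q) = 0 by rewrite /ips /im/= addNr.
have imsip p : ims (ip p) = 0 by rewrite /ims /ip/= addrN.
have ips0 u : ips u = 0 -> u = im u.2.
  by case: u => a b /=; rewrite /ips /im/= => /eqP; rewrite addr_eq0 => /eqP ->.
pose Ap := ips \o N \o ip.
pose Am x := - ims (Ni (im x)).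
have ApA : adjp Ap Ap.
  by move=> x y; rewrite /Ap/= (adjp_sym ipA) NN ipA.
have AmA : adjp Am Am.
  by move=> x y; rewrite /Am/= innerNl (adjp_sym imA) NiNi imA innerNr.
have [|Sp SpA [SpI1 SpI2 SpI3]] := pos_inv_sqrt e0 ApA.
  by move=> x; rewrite /Ap/= (adjp_sym ipA); exact: Npos.
have [|Sm SmA [SmI1 SmI2 SmI3]] := pos_inv_sqrt e0 AmA.
  move=> x; rewrite /Am/= innerNl (adjp_sym imA).
  by rewrite (_ : complex.Re (- _) = - complex.Re (inner (Ni (im x)) (im x)))
     ?Nneg//; case: (inner _ _).
have lip := adjp_linear ipA; have lips := adjp_linear (adjp_sym ipA).
have lim := adjp_linear imA; have lims := adjp_linear (adjp_sym imA).
have lSp := adjp_linear SpA; have lSm := adjp_linear SmA.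
pose h : R[i] := 2^-1.
have hJ : h^* = h by rewrite /h fmorphV rmorph_nat.
have hh : h + h = 1.
  by rewrite -mulr2n -[_ *+ 2]mulr_natr mulVf.
(* Weighting one coordinate by 1/2 avoids a square root of 2:
   [|a/2 + b|^2 - |a/2 - b|^2 = 2 Re <a, b>], the form of [J1]. *)
pose cay (u : hsum X X) : hsum X X := (h *: u.1 + u.2, h *: u.1 - u.2).
pose cays (u : hsum X X) : hsum X X := (h *: (u.1 + u.2), u.1 - u.2).
have cayA : adjp cay cays.
  move=> x y; rewrite !inner_hsum /cay /cays /=.
  by rewrite innerDl !innerBl !innerBr !innerZr !innerDr !innerZl hJ; ring.
pose D (u : hsum X X) : hsum X X := (u.1, - u.2).
have hDh (a : X) : h *: a + h *: a = a by rewrite -scalerDl hh scale1r.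
have cayD u : cays (D (cay u)) = J1 u.
  rewrite /cays /D /cay /J1 /= opprK; congr pair.
    by rewrite opprB addrC addrA subrK scalerDr hDh.
  by rewrite addrACA subrr addr0 hDh.
have cayJ u : cay (J1 (cays u)) = D u.
  rewrite /cays /D /cay /J1 /= -scalerDr -scalerBr; congr pair.
    by rewrite addrACA addrA subrK scalerDr hDh.
  by rewrite opprD addrACA subrr add0r scalerDr hDh.
pose W0 (u : hsum X X) := ip (Sp u.1) + Ni (im (Sm u.2)).
pose Ws0 (x : hsum X X) : hsum X X := (Sp (ips x), Sm (ims (Ni x))).
have W0A : adjp W0 Ws0.
  by move=> x y; rewrite innerDl NiNi ipA imA SpA SmA.
have W0N u : Ws0 (N (W0 u)) = D u.
  rewrite /Ws0 /D; congr pair.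
    by rewrite (linD lN) (linD lips) NiK ipsim addr0; exact: SpI1.
  rewrite NK (linD lims) imsip add0r -[ims _]opprK (linN lSm); congr (- _).
  exact: SmI1.
have W0D x : W0 (D (Ws0 x)) = Ni x.
  (* [z] is split along the two subspaces: [Sp \o Sp] inverts [Ap], so the subtracted term is the
     component in the graph of [G], and [N y] is orthogonal to that graph. *)
  pose z := Ni x; pose y := z - ip (Sp (Sp (ips (N z)))).
  have yN : N y = im (N y).2.
    apply: ips0; rewrite (linB lN) (linB lips).
    by rewrite [ips (N (ip _))](SpI2) subrr.
  have yE : y = Ni (im (N y).2) by rewrite -yN NK.
  have imsz : ims z = - Am (N y).2.
    by rewrite /Am -yE opprK /y (linB lims) imsip subr0.
  have SSz : Sm (Sm (ims z)) = - (N y).2.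
    by rewrite imsz; do 2 rewrite (linN lSm); rewrite SmI3.
  rewrite /W0 /D /Ws0 /= -/z (linN lSm) SSz opprK -yE -{1}(NiK x) -/z.
  by rewrite /y addrC subrK.
exists (W0 \o cay), (cays \o Ws0); split.
- exact: adjp_comp.
- by move=> x; rewrite /= W0N cayD.
- by move=> x; rewrite /= cayJ W0D.
Qed.

End Indefinite.

(** * Regular points of a simple symmetric operator *)

Section RegularPoints.
Context {R : realType} {X : hilbertType R}.

Lemma closed_cl (S : set X) : cl S `<=` S -> closed S.
Proof.
move=> clS x Sx; apply: clS => e e0.
have [|y [Sy xy]] := Sx (ball x e%:C%C); first by apply: nbhsx_ballx; rewrite ltcR.
by exists y => //; move: xy; rewrite -ball_normE/= nmE ltcR.
Qed.

Lemma nm_pair_lt (a b : X) (e : R) :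
  nm a < e -> nm b < e -> nm ((a, b) : (X * X)%type) < e.
Proof.
rewrite -!ltcR -!nmE => ae be; rewrite prod_normE/= /Order.max.
by case: ifP.
Qed.

Variable E : linop X.
Hypothesis E_closed : closed_op E.
Hypothesis E_symmetric : symmetric_op E.

Let dS := dom_subspace E.

Lemma lopB f g : dom E f -> dom E g -> E (f - g) = E f - E g.
Proof.
by move=> df dg; rewrite addrC -scaleN1r lop_linear// scaleN1r addrC.
Qed.

Lemma closed_op_lim f h :
  (forall e : R, 0 < e ->
    exists g, [/\ dom E g, nm (f - g) < e & nm (h - E g) < e]) ->
  dom E f /\ h = E f.
Proof.
move=> lim_f; apply: (closed_nm (x := (f, h)) E_closed) => e e0.
have [g [dg fg hg]] := lim_f _ e0.
by exists (g, E g) => //=; exact: nm_pair_lt.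
Qed.

(* For real [xi] the eigenspace reduces [E] to a self-adjoint operator. *)
Lemma simple_op_no_eigenvector xi f :
  simple_op E -> dom E f -> E f = xi *: f -> f = 0.
Proof.
move=> E_simple df Ef.
have [xi_real|xi_nreal] := eqVneq xi xi^*; last first.
  have := E_symmetric df df; rewrite Ef innerZl innerZr => /eqP.
  rewrite -subr_eq0 -mulrBl mulf_eq0 subr_eq0 (negbTE xi_nreal)/= => /eqP.
  exact: inner_eq0.
pose M := [set g | dom E g /\ E g = xi *: g].
suff M0 : M = [set 0].
  by have : M f by []; rewrite M0.
have sM : lin_subspace M.
  split.
    split; first exact: dS.1.
    by rewrite -(subrr f) lopB// !subrr scaler0.
  move=> a x y [dx Ex] [dy Ey]; split; first exact: dS.2.
  by rewrite lop_linear// Ex Ey scalerDr !scalerA mulrC.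
have clM : cl M `<=` M.
  move=> x clx; have [|dx xE] := @closed_op_lim x (xi *: x); last by split.
  move=> e e0.
  have d0 : 0 < 1 + nm xi by rewrite ltr_pwDl// nm_ge0.
  have [|y [dy Ey] xy] := clx (e / (1 + nm xi)); first by rewrite divr_gt0.
  have {}xy : nm (x - y) + nm xi * nm (x - y) < e.
    by rewrite -{1}[nm (x - y)]mul1r -mulrDl mulrC -ltr_pdivlMr.
  exists y; split=> //.
    by apply: le_lt_trans xy; rewrite lerDl mulr_ge0 ?nm_ge0.
  by rewrite Ey -scalerBr nmZ; apply: le_lt_trans xy; rewrite lerDr nm_ge0.
apply: E_simple.
  split=> //.
  - exact: closed_cl.
  - move=> g dg; have [p /clM Mp op] := proj_cl sM g.
    exists p, (g - p); split=> //.
    - exact: Mp.1.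
    - by apply: (subspB dS) => //; exact: Mp.1.
    - by rewrite addrC subrK.
  - by move=> g _ Mg; rewrite Mg.2; exact: (subspZ sM).
  - move=> h dh oh m Mm; rewrite -E_symmetric//; last exact: Mm.1.
    by rewrite Mm.2 innerZl oh// mulr0.
split.
  by move=> x Mx; apply: subset_closure; split=> //; exact: Mx.1.
move=> g h Mg Mh; split=> [gh|[_ <-]]; last first.
  by move=> k dk _; apply: E_symmetric => //; exact: Mg.1.
split; first exact: Mg.1.
rewrite Mg.2; have Mk : M (xi *: g - h) by apply: (subspB sM) => //; exact: subspZ.
have := gh _ Mk.1 Mk; rewrite Mk.2 => kgh.
apply/subr0_eq/inner_eq0; rewrite innerBr innerZr -kgh innerZl -xi_real.
exact: subrr.
Qed.

Hypothesis E_simple : simple_op E.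
Variable Y : set X.
Hypothesis Y_subspace : lin_subspace Y.
Hypothesis Y_closed : closed Y.

Section Point.
Variable xi : R[i].
Hypothesis xi_regular : regular_point E Y xi.

Local Notation P := (P_ E Y xi).
Local Notation tau := (tau_ E Y xi).

Lemma P_tauP f : [/\ Y (P f), dom E (tau f) & E (tau f) - xi *: tau f = f - P f].
Proof.
have [_ dec _] := xi_regular.
have [m [y [rm Yy fE]]] := dec f.
have [YP [w dw wE]] : Y (P f) /\ rng E xi (f - P f).
  by apply: (@xgetPex _ _ [set y | Y y /\ _]); exists y; split=> //; rewrite fE addrK.
suff [] : dom E (tau f) /\ E (tau f) - xi *: tau f = f - P f by split.
by apply: (@xgetPex _ _ [set g | dom E g /\ _]); exists w.
Qed.

(** The decomposition determines [y] because [rng E xi] meets [Y] only in 0, and [g] because a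
    simple symmetric operator has no eigenvectors. Linearity, closedness of the graphs and the
    resolvent identity follow by exhibiting decompositions. *)
Lemma P_tau_uniq f y g :
  Y y -> dom E g -> E g - xi *: g = f - y -> P f = y /\ tau f = g.
Proof.
move=> Yy dg gE; have [YP dt tE] := P_tauP f.
have [_ _ rY] := xi_regular.
have dd : dom E (tau f - g) by exact: (subspB dS).
have dE : E (tau f - g) - xi *: (tau f - g) = y - P f.
  have -> : y - P f = (f - P f) - (f - y) by rewrite opprB [RHS]addrC subrKA.
  by rewrite lopB// scalerBr -tE -gE opprB opprD opprK !addrA addrAC (addrAC (E _)).
have yP : y - P f = 0.
  suff : (rng E xi `&` Y) (y - P f) by rewrite rY.
  split; last exact: (subspB Y_subspace).
  by exists (tau f - g).
split; first by apply/esym/subr0_eq.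
apply/subr0_eq/(@simple_op_no_eigenvector xi) => //.
by apply: subr0_eq; rewrite dE.
Qed.

Lemma P_tau_linear : linear P /\ linear tau.
Proof.
have lin a f g : P (a *: f + g) = a *: P f + P g /\
    tau (a *: f + g) = a *: tau f + tau g.
  have [Yf df Ef] := P_tauP f; have [Yg dg Eg] := P_tauP g.
  apply: P_tau_uniq; [exact: Y_subspace.2|exact: dS.2|].
  rewrite lop_linear// scalerDr scalerA mulrC -scalerA opprD addrACA -scalerBr Ef Eg.
  by rewrite scalerBr addrACA opprD.
by split=> a f g; have [] := lin a f g.
Qed.

(** By the closed graph theorem: the graph of [P] is closed because [Y] and [rng E xi] are, and then
    that of [tau] because [E] is closed and [P] is bounded. *)
Lemma P_tau_adj : exists Ps taus, adjp P Ps /\ adjp tau taus.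
Proof.
have [lP ltau] := P_tau_linear.
have [cM _ _] := xi_regular.
have [Ps PPs] : exists Ps, adjp P Ps.
  apply: closed_graph => // x y gxy.
  have Yy : Y y.
    apply: (closed_nm Y_closed) => e e0; have [f [_ fy]] := gxy _ e0.
    by exists (P f) => //; have [] := P_tauP f.
  have [g dg gE] : rng E xi (x - y).
    apply: (closed_nm cM) => e e0.
    have e20 : 0 < e / 2 by rewrite divr_gt0.
    have [f [fx fy]] := gxy _ e20; have [_ df Ef] := P_tauP f.
    exists (f - P f); first by exists (tau f).
    have -> : x - y - (f - P f) = (x - f) - (y - P f).
      by rewrite !opprD addrACA.
    by rewrite (le_lt_trans (nmD _ _))// nmN (splitr e) ltrD.
  by have [] := P_tau_uniq Yy dg gE.
have [c c0 Pc] := adjp_bounded PPs.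
have [taus tt] : exists taus, adjp tau taus.
  apply: closed_graph => // x y gxy.
  have [Yx _ _] := P_tauP x.
  have [|dy yE] := @closed_op_lim y (xi *: y + (x - P x)).
    move=> e e0.
    (* [d] exceeds the sum of the coefficients [nm xi], 1 and [c] of the three error terms below. *)
    pose d := 1 + nm xi + c + 1.
    have xi0 := nm_ge0 xi.
    have d0 : 0 < d by rewrite /d; lra.
    have [|f [xf yf]] := gxy (e / d); first by rewrite divr_gt0.
    have [_ df Ef] := P_tauP f.
    have ed : e / d * d = e by rewrite divfK// gt_eqF.
    exists (tau f); split=> //.
      apply: lt_le_trans yf _; rewrite ler_pdivrMr// ler_peMr// ?ltW// /d; lra.
    have -> : xi *: y + (x - P x) - E (tau f) =
        xi *: (y - tau f) + ((x - f) - P (x - f)).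
      have -> : E (tau f) = xi *: tau f + (f - P f) by rewrite -Ef addrC subrK.
      rewrite (linB lP) scalerBr (opprD (xi *: _)) addrACA; congr (_ + _).
      by rewrite !opprD addrACA.
    apply: le_lt_trans (nmD _ _) _; rewrite nmZ.
    apply: le_lt_trans (lerD (lexx _) (nmD _ _)) _; rewrite nmN.
    have h1 := Pc (x - f).
    have h2 : nm xi * nm (y - tau f) <= nm xi * (e / d) by rewrite ler_wpM2l// ltW.
    have h3 : c * nm (x - f) <= c * (e / d) by rewrite ler_pM2l// ltW.
    have : e / d * d = e by [].
    have : 0 < e / d by rewrite divr_gt0.
    rewrite [in _ * d]/d.
    move: h1 h2 h3 xf; set q := e / d => h1 h2 h3 xf q0 <-.
    lra.
  have [] := @P_tau_uniq x (P x) y Yx dy.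
    by rewrite -yE addrC addKr.
  by move=> _ <-.
by exists Ps, taus.
Qed.

End Point.

(** With [t = tau_ E Y la f] and [y = P_ E Y la f], the equation
    [(E - mu) t = f - y + (la - mu) t = g - y] is the decomposition of [g] at [mu]. *)
Lemma tau_resolvent la mu : regular_point E Y la -> regular_point E Y mu ->
  forall f, let g := f + (la - mu) *: tau_ E Y la f in
  P_ E Y la f = P_ E Y mu g /\ tau_ E Y la f = tau_ E Y mu g.
Proof.
move=> rla rmu f g.
have [Yf df Ef] := P_tauP rla f.
have [] := P_tau_uniq rmu (f := g) Yf df; last by move=> -> ->.
rewrite /g scalerBl addrAC -Ef.
by rewrite addrA subrK.
Qed.

End RegularPoints.

(** * The kernel [J - rho K] *)

Section Resolvent.
Context {R : realType} {X : hilbertType R}.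

Definition pii : R[i] := (pi : R)%:C%C * 'i.

Lemma pii_neq0 : pii != 0.
Proof.
rewrite mulf_neq0 ?neq0Ci// (inj_eq (@complexI _) _ 0).
by rewrite gt_eqF// pi_gt0.
Qed.

Lemma pii_conj : pii^* = - pii.
Proof.
rewrite rmorphM/= conjCi mulrN; congr (- (_ * _)).
exact: conjc_real.
Qed.

Lemma rhoE (xi la : R[i]) : rho xi la = - (2 * pii * (la - xi^*)).
Proof. by rewrite /rho mulNr mulrA. Qed.

Variables (Omega : set R[i]) (P Ps tau taus : R[i] -> X -> X).
Hypothesis Omega_conj : forall xi, Omega xi -> Omega xi^*.
Hypothesis P_adj : forall xi, Omega xi -> adjp (P xi) (Ps xi).
Hypothesis tau_adj : forall xi, Omega xi -> adjp (tau xi) (taus xi).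
Hypothesis P_res : forall la mu, Omega la -> Omega mu -> forall f,
  P la f = P mu (f + (la - mu) *: tau la f).
Hypothesis tau_res : forall la mu, Omega la -> Omega mu -> forall f,
  tau la f = tau mu (f + (la - mu) *: tau la f).
(** This is [<E t, s> = <t, E s>] for [t = tau w^* f] and [s = tau w g], after substituting
    [E t = f - P w^* f + w^* t] and [E s = g - P w g + w s]; the terms in [<t, s>] cancel. *)
Hypothesis P_tau_sym : forall w, Omega w -> forall f g,
  inner (tau w^* f) (P w g) - inner (P w^* f) (tau w g) =
  inner (tau w^* f) g - inner f (tau w g).

(** The value at [xi] of the element of H1 given by [f]; [evs xi] is the adjoint of [ev xi]. *)
Definition ev (xi : R[i]) (f : X) : hsum X X := (P xi f, pii^-1 *: tau xi f).
Definition evs (xi : R[i]) (u : hsum X X) : X :=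
  Ps xi u.1 + (pii^-1)^* *: taus xi u.2.

Lemma ev_adj xi : Omega xi -> adjp (ev xi) (evs xi).
Proof.
move=> Oxi x y; rewrite inner_hsum /evs/= innerDr innerZr conjCK innerZl.
by rewrite P_adj// tau_adj.
Qed.

Lemma ev_res la mu : Omega la -> Omega mu -> forall f,
  ev la f = ev mu (f + (la - mu) *: tau la f).
Proof. by move=> Ol Om f; rewrite /ev -P_res// -tau_res. Qed.

Lemma evs_res la mu : Omega la -> Omega mu -> forall u,
  evs la u = evs mu u + (la - mu)^* *: taus la (evs mu u).
Proof.
move=> Ol Om u; apply: inner_inj => f.
rewrite -ev_adj// (ev_res Ol Om) ev_adj// innerDl innerDr innerZl innerZr.
by rewrite conjCK tau_adj.
Qed.

(** The operator form of [P_tau_sym]: paired with [g], [J1] couples [P] with [tau / (pi i)], and the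
    minus sign on its left side appears because [pi i] is imaginary. *)
Lemma evs_J1_ev w : Omega w -> forall f,
  evs w (J1 (ev w^* f)) = pii^-1 *: (tau w^* f - taus w f).
Proof.
move=> Ow f; apply: inner_injl => g.
rewrite (adjp_sym (ev_adj Ow)) inner_hsum /ev /J1/= !innerZl innerBl.
rewrite (adjp_sym (tau_adj Ow)) innerZr -P_tau_sym//.
by rewrite fmorphV/= pii_conj invrN; ring.
Qed.

(* [J - rho_w(la) K_w(la)] with [K_w(la) = ev la (evs w) / 2] the reproducing
   kernel of H1; this is what [U la J (U w)^*] has to be. *)
Definition Jker (w la : R[i]) (u : hsum X X) : hsum X X :=
  J1 u - (rho w la / 2) *: ev la (evs w u).

Lemma rho_conj (w la : R[i]) : (rho w la)^* = rho la w.
Proof.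
rewrite !rhoE rmorphN rmorphM rmorphM/= pii_conj rmorphB/= conjCK rmorph_nat.
by ring.
Qed.

Lemma Jker_adj w la : Omega w -> Omega la -> adjp (Jker w la) (Jker la w).
Proof.
move=> Ow Ol x y; rewrite /Jker innerBl innerBr innerZl innerZr J1_adjp.
rewrite ev_adj// (adjp_sym (ev_adj Ow)).
by rewrite rmorphM/= rho_conj fmorphV rmorph_nat.
Qed.

Lemma Jker_conj w u : Jker w w^* u = J1 u.
Proof. by rewrite /Jker rhoE subrr mulr0 oppr0 mul0r scale0r subr0. Qed.

Lemma J1K : involutive (J1 : hsum X X -> hsum X X).
Proof. by case. Qed.

Lemma J1_linear : linear (J1 : hsum X X -> hsum X X).
Proof. exact: adjp_linear J1_adjp. Qed.

(* Writing every term as [ev la] of a combination of [v], [tau w^* v] and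
   [taus w v], where [v = evs nu u], the three coefficients match. *)
Lemma Jker_cocycle w la nu : Omega w -> Omega la -> Omega nu -> forall u,
  Jker w la (J1 (Jker nu w^* u)) = Jker nu la u.
Proof.
move=> Ow Ol On u; have Ow' := Omega_conj Ow.
have lev := adjp_linear (ev_adj Ol); have levs := adjp_linear (adjp_sym (ev_adj Ow)).
rewrite /Jker; set v := evs nu u.
set a := rho w la / 2; set b := rho nu w^* / 2; set c := rho nu la / 2.
rewrite (linB J1_linear) (linZ J1_linear) J1K.
rewrite (linB J1_linear) (linZ J1_linear) J1K.
rewrite (linB levs) (linZ levs) (evs_J1_ev Ow) (evs_res Ow On) -/v.
rewrite (ev_res Ow' Ol) -addrA -opprD; congr (_ - _).
rewrite -!(linZ lev) -(linD lev); congr (ev la _).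
have ab : b + a = c by rewrite /a /b /c !rhoE; field.
have t1 : b * (w^* - la) - a * (b * pii^-1) = 0.
  by rewrite /a /b !rhoE; field; exact: pii_neq0.
have t2 : a * (w - nu)^* + a * (b * pii^-1) = 0.
  by rewrite /a /b !rhoE rmorphB/=; field; exact: pii_neq0.
rewrite -ab.
move: (tau _ v) (taus _ v) => t s; clearbody v.
have -> : b *: (v + (w^* - la) *: t) +
    a *: (v + (w - nu)^* *: s - b *: (pii^-1 *: (t - s))) =
  (b + a) *: v + (b * (w^* - la) - a * (b * pii^-1)) *: t +
    (a * (w - nu)^* + a * (b * pii^-1)) *: s.
  rewrite scalerA [(b * _) *: _]scalerBr opprB !scalerDr scalerN !scalerA.
  rewrite !scalerDl scaleNr.
  by rewrite (AC (2*(2*2)) (((1*3)*(2*6))*(4*5)))/=.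
by rewrite t1 t2 !scale0r !addr0.
Qed.

(** * Factorization of the kernel at a base point below the real axis *)

Section BasePoint.
Variables (Y : set X) (beta : R[i]) (a : R).
Hypotheses (Y_subspace : lin_subspace Y) (Y_closed : closed Y).
Hypothesis P_Y : forall xi y, Omega xi -> Y y -> P xi y = y /\ tau xi y = 0.
Hypothesis Obeta : Omega beta.
Hypothesis a_gt0 : 0 < a.
(** The left side is [-2 pi Im beta], so [beta] lies below the real axis, and
    [- rho beta beta / 2 = a] is the weight of the positive part of [Jker beta beta]. *)
Hypothesis beta_im : pii * (beta - beta^*) = a%:C%C.

(** [G] projects onto the orthogonal complement of [Y]; self-adjointness and idempotence both come
    from [<G x, z> = <G x, G z>]. *)
Lemma proj_ortho : exists G : X -> X, [/\ adjp G G,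
  forall x, G (G x) = G x & forall x, Y (x - G x)].
Proof.
have ex x : exists g, Y (x - g) /\ Defs.ortho Y g.
  have [p clp po] := proj_cl Y_subspace x.
  exists (x - p); split=> //; rewrite opprB addrC subrK.
  exact: closed_nm clp.
have [G GP] := choice ex.
have Gl x z : inner (G x) z = inner (G x) (G z).
  rewrite -{1}(subrK (G z) z) innerDr innerC.
  by rewrite (GP x).2 ?conjC0 ?add0r//; exact: (GP z).1.
have GG : adjp G G.
  by move=> x z; rewrite (Gl x z) [RHS]innerC (Gl z x) -innerC.
exists G; split=> // x; last exact: (GP x).1.
by apply: inner_injl => z; rewrite GG -(Gl x z).
Qed.

(* For [y] in [Y], [ev xi y = (y, 0)], so [evs xi (p, s)] dominates the
   component of [p] in [Y]. *)
Lemma ev_coercive xi (G : X -> X) : Omega xi -> adjp G G ->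
  (forall x, G (G x) = G x) -> (forall x, Y (x - G x)) ->
  forall p s, nm p ^+ 2 <= nm (evs xi (p, s)) ^+ 2 + nm (G p) ^+ 2.
Proof.
move=> Oxi GG G2 GY p s; pose y := p - G p.
have yG : inner y (G p) = 0.
  by rewrite innerBl -GG -(GG (G p)) G2 subrr.
have -> : nm p ^+ 2 = nm y ^+ 2 + nm (G p) ^+ 2.
  by rewrite -{1}(subrK (G p) p) nmD_sqr yG mulr0 addr0.
rewrite lerD2r ler_pXn2r ?nnegrE ?nm_ge0//.
have [->|y0] := eqVneq (nm y) 0; first exact: nm_ge0.
have {}y0 : 0 < nm y by rewrite lt_def y0 nm_ge0.
rewrite -(ler_pM2l y0); apply: le_trans (cauchy_schwarz _ _).
rewrite -ev_adj// inner_hsum /ev/=.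
have [-> ->] := P_Y Oxi (GY p); rewrite scaler0 inner0l addr0.
have -> : inner (p - G p) p = inner y y by rewrite {2}/y innerBr yG subr0.
by rewrite inner_nm nmr ger0_norm ?sqr_ge0.
Qed.

(* The inverse of [Jker beta beta] is [J1 \o Jker beta^* beta^* \o J1]. *)
Lemma base_factor : exists W Ws : hsum X X -> hsum X X, [/\ adjp W Ws,
  forall x, Ws (Jker beta beta (W x)) = J1 x &
  forall x, W (J1 (Ws x)) = J1 (Jker beta^* beta^* (J1 x))].
Proof.
have [G [GG G2 GY]] := proj_ortho.
have Ob := Omega_conj Obeta.
(* On [(p, G p)] the form of [J1] contributes [2 |G p|^2] and the kernel term [a |evs|^2]; the
   smaller weight times the bound of [ev_coercive] gives uniform positivity. *)
pose e := Num.min 2 a.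
have e0 : 0 < e by rewrite lt_min a_gt0 ltr0n.
have e2 : e <= 2 by rewrite ge_min lexx.
have ea : e <= a by rewrite ge_min lexx orbT.
have bound p s xi : Omega xi ->
    e * nm p ^+ 2 <= 2 * nm (G p) ^+ 2 + a * nm (evs xi (p, s)) ^+ 2.
  move=> Oxi; have h := ev_coercive Oxi GG G2 GY p s.
  apply: le_trans (ler_wpM2l (ltW e0) h) _.
  rewrite mulrDr addrC lerD// ler_wpM2r// sqr_ge0//.
have JG p : inner (J1 ((p, G p) : hsum X X)) (p, G p) = (2 * nm (G p) ^+ 2)%:C%C.
  rewrite inner_hsum /J1/= -[inner p _]GG.
  have -> : inner (G p) p = (nm (G p) ^+ 2)%:C%C by rewrite -inner_nm -GG G2.
  by rewrite -rmorphD/=; congr (_%:C)%C; ring.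
apply: (@indefinite_factor _ _ G (Jker beta beta)
  (fun x => J1 (Jker beta^* beta^* (J1 x))) e) => //.
- exact: Jker_adj.
- move=> x; have := Jker_cocycle Ob Ob Obeta x; rewrite conjCK => ->.
  by rewrite Jker_conj J1K.
- move=> x; rewrite Jker_cocycle//.
  by have := Jker_conj beta^* (J1 x); rewrite conjCK J1K.
- move=> p; rewrite {1}/Jker innerBl JG innerZl ev_adj// inner_nm.
  have -> : rho beta beta / 2 = - a%:C%C.
    by rewrite -beta_im rhoE; field.
  rewrite mulNr opprK -rmorphM -rmorphD/=; exact: bound.
(* [J1] moves [(- G q, q)] to [(q, - G q)], whose first component is again controlled by [bound]; at
   the conjugate point [rho] changes sign. *)
- move=> q; rewrite J1_adjp {1}/Jker innerBl innerZl ev_adj// inner_nm.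
  have -> : J1 ((- G q, q) : hsum X X) = (q, - G q) by [].
  have -> : rho beta^* beta^* / 2 = a%:C%C.
    by rewrite -beta_im rhoE conjCK; field.
  have -> : inner (J1 ((q, - G q) : hsum X X)) (q, - G q) =
      - (2 * nm (G q) ^+ 2)%:C%C.
    by rewrite -JG !inner_hsum /J1/= innerNl innerNr -opprD addrC.
  rewrite -opprD -rmorphM -rmorphD/= opprK; exact: bound.
Qed.

End BasePoint.
End Resolvent.

(** * Operator derivatives *)

Section Operators.
Context {R : realType}.

Lemma adjp_scale (V W : hilbertType R) (A : V -> W) As (c : R[i]) :
  adjp A As -> adjp (fun x => c *: A x) (fun y => c^* *: As y).
Proof. by move=> h x y; rewrite innerZl innerZr conjCK h. Qed.

Lemma adjp_sub (V W : hilbertType R) (A B : V -> W) As Bs :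
  adjp A As -> adjp B Bs -> adjp (fun x => A x - B x) (fun y => As y - Bs y).
Proof. by move=> h k x y; rewrite innerBl innerBr h k. Qed.

Lemma adjp_bounded_op (V : hilbertType R) (A B : V -> V) :
  adjp A B -> bounded_op A.
Proof.
move=> AB; split; first exact: adjp_linear AB.
have [c c0 Ac] := adjp_bounded AB.
by exists c%:C%C => x; rewrite !nmE -rmorphM lecR.
Qed.

Lemma adjointE (V : hilbertType R) (A B : V -> V) : adjp A B -> adjoint A = B.
Proof.
move=> AB; apply/funext => y; rewrite /adjoint; apply: xget_unique => /=.
  by move=> x; exact: AB.
by move=> z h; apply: inner_inj => x; rewrite -h AB.
Qed.

Lemma near0_nm (Q : R[i] -> Prop) (d : R) : 0 < d ->
  (forall h, h != 0 -> nm h < d -> Q h) -> \forall h \near (0 : R[i]^o)^', Q h.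
Proof.
move=> d0 hQ; rewrite near_withinE; apply/nbhs_ballP.
exists d%:C%C; first by rewrite /= ltcR.
move=> h; rewrite -ball_normE/= sub0r normrN nmE ltcR => hd h0.
exact: hQ.
Qed.

Lemma op_is_derive_bound (V : hilbertType R) (U : R[i] -> V -> V) z D (K d : R) :
  bounded_op D -> 0 < d ->
  (forall h, h != 0 -> nm h < d -> forall x,
     nm (h^-1 *: (U (h + z) x - U z x) - D x) <= K * nm h * nm x) ->
  op_is_derive U z D.
Proof.
move=> bD d0 UD; split=> // e e0.
have eE : (complex.Re e)%:C%C = e by rewrite RRe_real// gtr0_real.
have Re0 : 0 < complex.Re e by rewrite -ltcR eE.
have K1 : 0 < `|K| + 1 by rewrite ltr_wpDl.
apply: (@near0_nm _ (Num.min d (complex.Re e / (`|K| + 1)))).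
  by rewrite lt_min d0 divr_gt0.
move=> h h0; rewrite lt_min => /andP[hd he] x.
rewrite !nmE -eE -rmorphM lecR (le_trans (UD _ h0 hd x))//.
rewrite ler_wpM2r ?nm_ge0//; move: he; rewrite ltr_pdivlMr// mulrC => /ltW.
apply: le_trans; rewrite ler_wpM2r ?nm_ge0//.
by rewrite (le_trans (ler_norm _))// lerDl.
Qed.

Lemma op_is_derive_uniq (V : hilbertType R) (U : R[i] -> V -> V) z D1 D2 :
  op_is_derive U z D1 -> op_is_derive U z D2 -> D1 = D2.
Proof.
move=> [_ h1] [_ h2]; apply/funext => x; apply/subr0_eq/nm_eq0/le_anti.
rewrite nm_ge0 andbT; apply/ler_addgt0Pr => e e0; rewrite add0r.
pose d := e / 2 / (nm x + 1).
have x1 : 0 < nm x + 1 by rewrite ltr_wpDl ?nm_ge0.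
have d0 : 0 < d by rewrite !divr_gt0.
have dC : 0 < d%:C%C by rewrite ltcR.
have PF : ProperFilter ((0 : R[i]^o)^') by exact: Proper_dnbhs_numFieldType.
have [h [/(_ x) k1 /(_ x) k2]] := filter_ex (filterI (h1 _ dC) (h2 _ dC)).
move: k1 k2; rewrite !nmE -rmorphM !lecR => k1 k2.
apply: le_trans (nm_trans (h^-1 *: (U (h + z) x - U z x)) _ _) _.
rewrite nmC (splitr e); apply: lerD.
  apply: le_trans k1 _; rewrite /d mulrAC ler_pdivrMr// ler_wpM2l ?lerDl//.
  by rewrite divr_ge0// ltW.
apply: le_trans k2 _; rewrite /d mulrAC ler_pdivrMr// ler_wpM2l ?lerDl//.
by rewrite divr_ge0// ltW.
Qed.

Lemma op_deriveE (V : hilbertType R) (U : R[i] -> V -> V) z D :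
  op_is_derive U z D -> op_derive U z = D.
Proof.
move=> UD; apply: xget_unique => //= D' UD'; exact: op_is_derive_uniq UD' UD.
Qed.

Lemma derivable_bound (V : hilbertType R) (F : R[i] -> V) z l (K d : R) : 0 < d ->
  (forall h, h != 0 -> nm h < d ->
     nm (h^-1 *: (F (h + z) - F z) - l) <= K * nm h) ->
  derivable (F : R[i]^o -> V) z 1.
Proof.
move=> d0 Fl; apply/cvg_ex; exists l; apply/cvgrPdist_le => e e0.
have eE : (complex.Re e)%:C%C = e by rewrite RRe_real// gtr0_real.
have Re0 : 0 < complex.Re e by rewrite -ltcR eE.
have K1 : 0 < `|K| + 1 by rewrite ltr_wpDl.
apply: (@near0_nm _ (Num.min d (complex.Re e / (`|K| + 1)))).
  by rewrite lt_min d0 divr_gt0.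
move=> h h0; rewrite lt_min => /andP[hd he].
rewrite nmE -eE lecR nmC [h *: 1]mulr1 (le_trans (Fl _ h0 hd))//.
move: he; rewrite ltr_pdivlMr// mulrC => /ltW.
apply: le_trans; rewrite ler_wpM2r ?nm_ge0//.
by rewrite (le_trans (ler_norm _))// lerDl.
Qed.

(** This serves to identify the derivative of [U] applied to one fixed vector with that of [Jker]
    applied to another, where only the two vector-valued quotients agree. *)
Lemma quotient_lim_uniq (V : hilbertType R) (q : R[i] -> V) l1 l2 (K1 K2 d1 d2 : R) :
  0 < d1 -> 0 < d2 ->
  (forall h, h != 0 -> nm h < d1 -> nm (q h - l1) <= K1 * nm h) ->
  (forall h, h != 0 -> nm h < d2 -> nm (q h - l2) <= K2 * nm h) -> l1 = l2.
Proof.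
move=> d10 d20 q1 q2; apply/subr0_eq/nm_eq0/le_anti; rewrite nm_ge0 andbT.
have half01 : 0 <= (2^-1 : R) < 1 by lra.
pose d := Num.min d1 d2 / 2.
have m0 : 0 < Num.min d1 d2 by rewrite lt_min d10.
have d0 : 0 < d by rewrite divr_gt0.
apply: (@geo_le0 _ ((K1 + K2) * d) 2^-1) => // n.
pose h : R[i] := (d * 2^-1 ^+ n)%:C%C.
have nh : nm h = d * 2^-1 ^+ n by rewrite nmr ger0_norm// mulr_ge0 ?exprn_ge0// ltW.
have hd : nm h < Num.min d1 d2.
  rewrite nh (@le_lt_trans _ _ d)//.
    by rewrite ler_piMr ?(ltW d0)// exprn_ile1//; lra.
  by rewrite /d ltr_pdivrMr// ltr_pMr// ltr1n.
have h0 : h != 0.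
  by apply/eqP => hz; move: nh; rewrite hz nm0 => /esym/eqP;
    rewrite mulf_eq0 gt_eqF//= expf_eq0 invr_eq0 pnatr_eq0 andbF.
move: hd; rewrite lt_min => /andP[hd1 hd2].
apply: le_trans (nm_trans (q h) _ _) _; rewrite nmC -mulrA -nh mulrDl.
by apply: lerD; [exact: q1|exact: q2].
Qed.

End Operators.

(** * Complex differentiability of the evaluation maps and of the kernel *)

Section Derivative.
Context {R : realType} {X : hilbertType R}.
Variables (Omega : set R[i]) (P Ps tau taus : R[i] -> X -> X).
Hypothesis Omega_open : open (Omega : set R[i]^o).
Hypothesis P_adj : forall xi, Omega xi -> adjp (P xi) (Ps xi).
Hypothesis tau_adj : forall xi, Omega xi -> adjp (tau xi) (taus xi).
Hypothesis P_res : forall la mu, Omega la -> Omega mu -> forall f,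
  P la f = P mu (f + (la - mu) *: tau la f).
Hypothesis tau_res : forall la mu, Omega la -> Omega mu -> forall f,
  tau la f = tau mu (f + (la - mu) *: tau la f).

Local Notation ev := (ev P tau).
Local Notation evs := (evs Ps taus).
Local Notation Jker := (Jker P Ps tau taus).

Lemma open_nm z : Omega z -> exists2 d : R, 0 < d &
  forall h, nm h < d -> Omega (h + z).
Proof.
move=> Oz; have /nbhs_ballP[e e0 eO] := open_nbhs_nbhs (conj Omega_open Oz).
have eE : (complex.Re e)%:C%C = e by rewrite RRe_real// gtr0_real.
exists (complex.Re e); first by rewrite -ltcR eE.
move=> h hd; apply: eO; rewrite -ball_normE/=.
by rewrite opprD addrCA subrr addr0 normrN nmE -eE ltcR.
Qed.

(** By the resolvent identity [ev (h + z) f = ev z (f + h *: f')] with [f' = tau (h + z) f]. So the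
    difference quotient is exactly [ev z f'], and [f' - tau z f = h *: tau z f'] makes the error
    linear in [h]. *)
Lemma ev_deriv z : Omega z -> exists K d : R, [/\ 0 <= K, 0 < d &
  forall h, h != 0 -> nm h < d -> Omega (h + z) /\ forall f,
    nm (h^-1 *: (ev (h + z) f - ev z f) - ev z (tau z f)) <= K * nm h * nm f].
Proof.
move=> Oz; have [d d0 dO] := open_nm Oz.
have evA := ev_adj P_adj tau_adj Oz; have lev := adjp_linear evA.
have lt := adjp_linear (tau_adj Oz).
have [t t0 tP] := adjp_bounded (tau_adj Oz).
have [b b0 bP] := adjp_bounded evA.
exists (b * (t * (2 * t))), (Num.min d (2 * t)^-1); split.
- by rewrite !mulr_ge0// ltW.
- by rewrite lt_min d0 invr_gt0 mulr_gt0.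
move=> h h0; rewrite lt_min => /andP[hd ht].
have Ohz := dO _ hd; split=> // f.
set f' := tau (h + z) f.
have f'E : f' = tau z (f + h *: f').
  by rewrite {1}/f' (tau_res Ohz Oz) addrK.
(* The radius [(2 * t)^-1] makes [t * nm h] at most 1/2, so the term in [f'] on the right of [f'E]
   is absorbed. *)
have nf' : nm f' <= 2 * t * nm f.
  have h1 : nm f' <= t * nm (f + h *: f') by rewrite {1}f'E.
  have h2 : t * nm (f + h *: f') <= t * (nm f + nm h * nm f').
    by rewrite ler_pM2l// (le_trans (nmD _ _))// nmZ.
  have h3 : t * (nm h * nm f') <= 2^-1 * nm f'.
    rewrite mulrA ler_wpM2r ?nm_ge0//.
    have := ltW ht; by rewrite invfM ler_pdivlMr// mulrC.
  by move: h1 h2 h3; rewrite mulrDr; lra.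
have evE : ev (h + z) f = ev z (f + h *: f').
  by rewrite (ev_res P_res tau_res Ohz Oz) addrK.
have -> : h^-1 *: (ev (h + z) f - ev z f) - ev z (tau z f) =
    ev z (h *: tau z f').
  rewrite evE (linD lev) (addrC (ev z f)) addrK (linZ lev) scalerA mulVf// scale1r.
  by rewrite -(linB lev) {1}f'E (linD lt) addrAC subrr add0r (linZ lt).
rewrite (linZ lev) nmZ [leRHS]mulrAC [leRHS]mulrC ler_wpM2l ?nm_ge0//.
rewrite -mulrA (le_trans (bP _))// ler_pM2l// -mulrA (le_trans (tP _))//.
by rewrite ler_pM2l.
Qed.

(** The product rule: [- rho w / 2] has slope [pii], and [ev] has the derivative found in
    [ev_deriv]. *)
Lemma Jker_deriv w z : Omega w -> Omega z ->
  exists K d : R, [/\ 0 <= K, 0 < d & forall h, h != 0 -> nm h < d ->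
    Omega (h + z) /\ forall u,
    nm (h^-1 *: (Jker w (h + z) u - Jker w z u) -
        (pii *: ev z (evs w u) - (rho w z / 2) *: ev z (tau z (evs w u)))) <=
      K * nm h * nm u].
Proof.
move=> Ow Oz; have [K [d [K0 d0 evD]]] := ev_deriv Oz.
have evA := ev_adj P_adj tau_adj Oz.
have [b b0 bP] := adjp_bounded (adjp_comp (tau_adj Oz) evA).
have [c c0 cP] := adjp_bounded (adjp_sym (ev_adj P_adj tau_adj Ow)).
pose r := rho w z / 2.
(* The remainder is [- r (q - T) + pii h q]; the two summands of [C] bound its two terms, with
   [|q| <= (K d + b) |v|]. *)
pose C := nm r * K + nm (pii : R[i]) * (K * d + b).
have C0 : 0 <= C by rewrite !(addr_ge0, mulr_ge0) ?nm_ge0// ltW.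
exists (C * c), d; split=> //; first by rewrite mulr_ge0// ltW.
move=> h h0 hd; have [Ohz hq] := evD h h0 hd; split=> // u; set v := evs w u.
set q := h^-1 *: (ev (h + z) v - ev z v); set T := ev z (tau z v).
have qT : nm (q - T) <= K * nm h * nm v by exact: hq.
have -> : h^-1 *: (Jker w (h + z) u - Jker w z u) - (pii *: ev z v - r *: T) =
    - (r *: (q - T)) + (pii * h) *: (T + (q - T)).
  have evq : ev (h + z) v = h *: q + ev z v.
    by rewrite /q scalerA mulfV// scale1r subrK.
  have rE : rho w (h + z) / 2 = r - pii * h.
    by rewrite /r !rhoE; field.
  have -> : Jker w (h + z) u - Jker w z u =
      h *: (pii *: ev z v - r *: q + (pii * h) *: q).
    rewrite /Jker -/v rE -/r evq opprB addrC subrKA scalerBl !scalerDr scalerN.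
    rewrite !scalerA (mulrC h) (mulrC h r) (mulrC h (pii * h)).
    by rewrite opprB addrC opprD addrA subrK [RHS]addrC addrA.
  rewrite scalerA mulVf// scale1r (addrC T) subrK scalerBr.
  by rewrite !opprB -[_ - _ + (pii * h) *: q]addrA [LHS]addrC subrKA addrA.
apply: le_trans (nmD _ _) _; rewrite nmN !nmZ nmM.
have h1 : nm v <= c * nm u by exact: cP.
have h2 : nm (T + (q - T)) <= b * nm v + K * nm h * nm v.
  by rewrite (le_trans (nmD _ _))// lerD//; exact: bP.
have h3 : nm (T + (q - T)) <= (K * d + b) * nm v.
  apply: le_trans h2 _; rewrite -mulrDl ler_wpM2r ?nm_ge0// addrC lerD2r.
  by rewrite ler_wpM2l// ltW.
have h4 : nm r * nm (q - T) <= nm r * K * nm h * nm v.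
  by rewrite -!mulrA ler_wpM2l ?nm_ge0// mulrA.
have h5 : nm pii * nm h * nm (T + (q - T)) <= nm (pii : R[i]) * (K * d + b) * nm h * nm v.
  by rewrite -!mulrA ler_wpM2l ?nm_ge0// [leRHS]mulrCA ler_wpM2l ?nm_ge0.
apply: le_trans (lerD h4 h5) _; rewrite -!mulrDl -/C.
have -> : C * c * nm h * nm u = C * nm h * (c * nm u) by ring.
by rewrite ler_wpM2l ?mulr_ge0 ?nm_ge0.
Qed.

End Derivative.

(** * The space H1 *)

Section SymmetricOperator.
Context {R : realType} {X : hilbertType R}.

(** A point above the real axis is replaced by its conjugate, and a real one is pushed down by half
    the radius of a disc inside [Omega]. *)
Lemma open_below_real (Omega : set R[i]^o) : Omega !=set0 -> open Omega ->
  (forall xi : R[i], Omega xi -> Omega xi^*) ->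
  exists beta (a : R), [/\ Omega beta, 0 < a & pii * (beta - beta^*) = a%:C%C].
Proof.
move=> [z Oz] oO cO.
suff [beta Ob bI] : exists2 beta : R[i], Omega beta & complex.Im beta < 0.
  exists beta, (- (2 * pi * complex.Im beta)); split=> //.
    by rewrite oppr_gt0 pmulr_rlt0// mulr_gt0// pi_gt0.
  rewrite [beta^*]/(beta^*%C) subcJ /pii.
  rewrite complexiE -mulrA [_ * (_ * 'i)]mulrCA -expr2 sqrCi mulrN1 mulrN.
  by rewrite rmorphN !rmorphM/= rmorph_nat; congr (- _); ring.
have [zI|zI|zI] := ltgtP (complex.Im z) 0; first by exists z.
  exists z^*; first exact: cO.
  by case: z zI {Oz} => x y /=; rewrite oppr_lt0.
have [d d0 dO] := open_nm oO Oz.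
exists ((0 +i* (- (d / 2)))%C + z).
  apply: dO; rewrite /nm normc_def/= expr0n/= add0r sqrtr_sqr normrN.
  by rewrite ger0_norm ?divr_ge0 ?ltW// ltr_pdivrMr// ltr_pMr// ltr1n.
case: z zI {Oz dO} => x y /= ->.
by rewrite addr0 oppr_lt0 divr_gt0.
Qed.

Lemma sum_innerl (V : hilbertType R) (I : finType) (F : I -> V) y :
  inner (\sum_i F i) y = \sum_i inner (F i) y.
Proof.
by apply: (big_morph (fun x => inner x y)) => [u v|]; [exact: innerDl|exact: inner0l].
Qed.

Lemma sum_innerr (V : hilbertType R) (I : finType) (F : I -> V) y :
  inner y (\sum_i F i) = \sum_i inner y (F i).
Proof.
by apply: (big_morph (inner y)) => [u v|]; [exact: innerDr|exact: inner0r].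
Qed.

Variables (E : linop X) (Y : set X) (Omega : set R[i]^o).
Hypothesis E_simple : simple_op E.
Hypothesis E_closed : closed_op E.
Hypothesis E_symmetric : symmetric_op E.
Hypothesis Y_subspace : lin_subspace Y.
Hypothesis Y_closed : closed Y.
Hypothesis Omega_nonempty : Omega !=set0.
Hypothesis Omega_open : open Omega.
Hypothesis Omega_conj : forall xi : R[i], Omega xi -> Omega xi^*.
Hypothesis Omega_regular : forall xi : R[i], Omega xi -> regular_point E Y xi.

Local Notation P := (P_ E Y).
Local Notation tau := (tau_ E Y).

Lemma P_tau_symmetric w : Omega w -> forall f g,
  inner (tau w^* f) (P w g) - inner (P w^* f) (tau w g) =
  inner (tau w^* f) g - inner f (tau w g).
Proof.
move=> Ow f g.
have [_ df Ef] := P_tauP (Omega_regular (Omega_conj Ow)) f.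
have [_ dg Eg] := P_tauP (Omega_regular Ow) g.
have -> : P w g = g - (E (tau w g) - w *: tau w g) by rewrite Eg opprB addrC subrK.
have -> : P w^* f = f - (E (tau w^* f) - w^* *: tau w^* f).
  by rewrite Ef opprB addrC subrK.
rewrite !innerBr !innerBl innerZr innerZl E_symmetric//; ring.
Qed.

Lemma P_tau_Y xi y : Omega xi -> Y y -> P xi y = y /\ tau xi y = 0.
Proof.
move=> Oxi Yy; have d0 : dom E 0 := (dom_subspace E).1.
apply: P_tau_uniq => //; first exact: Omega_regular.
have E0 : E 0 = 0 by have := lopB d0 d0; rewrite !subrr.
by rewrite E0 scaler0 !subr0 subrr.
Qed.

Lemma H1_funE f xi : Omega xi -> H1_fun E Y Omega f xi = ev P tau xi f.
Proof. by move=> Oxi; rewrite /H1_fun /on_set patchT ?inE. Qed.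

Lemma H1_fun_off f xi : ~ Omega xi -> H1_fun E Y Omega f xi = 0.
Proof. by move=> Oxi; rewrite /H1_fun /on_set /patch memNset. Qed.

Lemma H1_fun_linear (a : R[i]) f g :
  H1_fun E Y Omega (a *: f + g) =
  (fun z => a *: H1_fun E Y Omega f z + H1_fun E Y Omega g z).
Proof.
apply/funext => z; have [Oz|Oz] := pselect (Omega z); last first.
  by rewrite !H1_fun_off// scaler0 addr0.
have [lP lt] := P_tau_linear E_closed E_symmetric E_simple Y_subspace (Omega_regular Oz).
by rewrite !H1_funE// /ev lP lt scalerDr scalerA mulrC -scalerA.
Qed.

Local Notation innerE := (H1_innerE Omega_nonempty Omega_regular).

Lemma H1_fun0 : H1_fun E Y Omega 0 = (fun=> 0).
Proof.
have := H1_fun_linear (-1) 0 0; rewrite scaler0 addr0 => ->.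
by apply/funext => z; rewrite scaleN1r addNr.
Qed.

(** Up to the factor [sqrt 2], [H1_fun] is an isometry, so the completeness of [X] passes to H1. *)
Lemma H1_fs_norm f g :
  fs_norm (H1 E Y Omega) (fun z => H1_fun E Y Omega f z - H1_fun E Y Omega g z) =
  (Num.sqrt 2 * nm (f - g))%:C%C.
Proof.
have -> : (fun z => H1_fun E Y Omega f z - H1_fun E Y Omega g z) =
    H1_fun E Y Omega (f - g).
  rewrite addrC -scaleN1r H1_fun_linear; apply/funext => z.
  by rewrite scaleN1r addrC.
rewrite /fs_norm innerE inner_nm -(rmorph_nat (real_complex R)) -rmorphM/=.
have -> : 2 * nm (f - g) ^+ 2 = (Num.sqrt 2 * nm (f - g)) ^+ 2 :> R.
  by rewrite exprMn sqr_sqrtr.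
rewrite rmorphXn/= sqrCK// ler0c mulr_ge0 ?sqrtr_ge0 ?nm_ge0//.
Qed.

Lemma H1_hilbert : hilbert_fun_space Omega (H1 E Y Omega).
Proof.
split.
- by move=> _ z [f _ <-]; exact: H1_fun_off.
- by exists 0 => //; exact: H1_fun0.
- move=> a _ _ [f _ <-] [g _ <-]; exists (a *: f + g) => //.
  exact: H1_fun_linear.
- move=> a _ _ _ [f _ <-] [g _ <-] [k _ <-].
  by rewrite -H1_fun_linear !innerE innerDl innerZl; ring.
- move=> _ _ [f _ <-] [g _ <-]; rewrite !innerE innerC rmorphM/=.
  by rewrite rmorph_nat.
- move=> _ [f _ <-] f0; rewrite innerE mulr_gt0// neq0_dnorm_gt0//.
  by apply: contra f0 => /eqP ->; rewrite H1_fun0.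
- move=> F_ FH; have ex n : exists f, H1_fun E Y Omega f = F_ n.
    by have [f _ fE] := FH n; exists f.
  have [f fE] := choice ex => Fc.
  have s0 : 0 < Num.sqrt 2 :> R by rewrite sqrtr_gt0.
  have : cvg (f @ \oo).
    apply: cauchy_cvg; apply/cauchy_exP => e e0.
    have [|N NP] := Fc ((Num.sqrt 2)%:C%C * e); first by rewrite mulr_gt0// ltcR.
    exists (f N), N => // m /= Nm; rewrite -ball_normE/= nmE.
    have := NP N m (leqnn N) Nm; rewrite -!fE H1_fs_norm rmorphM/=.
    by rewrite ltr_pM2l// ltcR.
  move=> /cvg_ex[/= l /cvgrPdist_lt fl].
  exists (H1_fun E Y Omega l); first by exists l.
  move=> e e0; have [|N _ NP] := fl (e / (Num.sqrt 2)%:C%C).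
    by rewrite divr_gt0// ltcR.
  exists N => n Nn; rewrite -fE H1_fs_norm rmorphM/= nmC -nmE mulrC.
  by rewrite -ltr_pdivlMr ?ltcR//; exact: NP.
Qed.

Lemma H1_is_HU : exists U : R[i] -> hsum X X -> hsum X X,
  [/\ op_analytic Omega U, J_identity Omega J1 U & is_HU Omega J1 U (H1 E Y Omega)].
Proof.
have ex xi : exists p : (X -> X) * (X -> X),
    Omega xi -> adjp (P xi) p.1 /\ adjp (tau xi) p.2.
  (* Off [Omega] the pair is a default value, so that [choice] yields adjoints indexed by the whole
     plane. *)
  have [Oxi|Oxi] := pselect (Omega xi); last by exists (id, id).
  have [Ps [taus h]] :=
    P_tau_adj E_closed E_symmetric E_simple Y_subspace Y_closed (Omega_regular Oxi).
  by exists (Ps, taus).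
have [p pP] := choice ex.
pose Ps xi := (p xi).1; pose taus xi := (p xi).2.
have P_adj xi : Omega xi -> adjp (P xi) (Ps xi) by move=> /pP[].
have tau_adj xi : Omega xi -> adjp (tau xi) (taus xi) by move=> /pP[].
have P_res la mu : Omega la -> Omega mu -> forall f,
    P la f = P mu (f + (la - mu) *: tau la f).
  move=> Ol Om f; exact: (tau_resolvent E_closed E_symmetric E_simple Y_subspace
    (Omega_regular Ol) (Omega_regular Om) f).1.
have tau_res la mu : Omega la -> Omega mu -> forall f,
    tau la f = tau mu (f + (la - mu) *: tau la f).
  move=> Ol Om f; exact: (tau_resolvent E_closed E_symmetric E_simple Y_subspace
    (Omega_regular Ol) (Omega_regular Om) f).2.
pose K := Jker P Ps tau taus; pose F := ev P tau; pose Fs := evs Ps taus.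
have coc := Jker_cocycle Omega_conj P_adj tau_adj P_res tau_res P_tau_symmetric.
have [b [a [Ob a0 ba]]] := open_below_real Omega_nonempty Omega_open Omega_conj.
have [W [Ws [WA WsW WWs]]] := base_factor Omega_conj P_adj tau_adj P_res tau_res
  P_tau_symmetric Y_subspace Y_closed P_tau_Y Ob a0 ba.
pose U la := K b la \o W.
have KA := Jker_adj P_adj tau_adj.
have UA la : Omega la -> adjp (U la) (Ws \o K la b).
  by move=> Ol; apply: adjp_comp; [exact: WA|exact: KA].
(* Writing [b'] for the conjugate of [b], the formula for [W J Ws] turns the left side into
   [N_b(la) J N_b'(b') J N_w(b)]; the cocycle identity collapses it to [N_b'(la) J N_w(b)] and then
   to [N_w(la)]. *)
have UUs w la u : Omega w -> Omega la -> U la (J1 (adjoint (U w) u)) = K w la u.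
  move=> Ow Ol; rewrite (adjointE (UA _ Ow)) /U /= WWs.
  have Ob' := Omega_conj Ob.
  rewrite /K coc//.
  by have := coc _ la w Ob' Ol Ow u; rewrite conjCK.
(* Between [Ws] and [W] stands [N_la'(b) J N_b(la) = N_b(b)], and [WsW] then gives [J1]. *)
have UsU la u : Omega la -> adjoint (U la^*) (J1 (U la u)) = J1 u.
  move=> Ol; have Ol' := Omega_conj Ol.
  rewrite (adjointE (UA _ Ol')) /U/= -(WsW u); congr Ws.
  by have := coc la^* b b Ol' Ob Ob (W u); rewrite conjCK.
have FA := ev_adj P_adj tau_adj.
have [cW _ WcW] := adjp_bounded WA.
have cW0 : 0 <= `|cW| := normr_ge0 cW.
have U_deriv z : Omega z -> op_is_derive U z (fun x =>
    pii *: F z (Fs b (W x)) - (rho b z / 2) *: F z (tau z (Fs b (W x)))).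
  move=> Oz; have [C [d [C0 d0 hd]]] :=
    Jker_deriv Omega_open P_adj tau_adj P_res tau_res Ob Oz.
  apply: (@op_is_derive_bound _ _ _ _ _ (C * cW) d) => //.
    have FF : adjp (fun x => F z (Fs b (W x))) (Ws \o (F b \o Fs z)).
      exact: (adjp_comp WA (adjp_comp (adjp_sym (FA _ Ob)) (FA _ Oz))).
    have FtF : adjp (fun x => F z (tau z (Fs b (W x))))
        (Ws \o (F b \o (taus z \o Fs z))).
      exact: (adjp_comp WA (adjp_comp (adjp_sym (FA _ Ob))
        (adjp_comp (tau_adj _ Oz) (FA _ Oz)))).
    exact: adjp_bounded_op (adjp_sub (adjp_scale _ FF) (adjp_scale _ FtF)).
  move=> h h0 hhd x; have [_ /(_ (W x))] := hd h h0 hhd.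
  move=> /le_trans; apply.
  have -> : C * cW * nm h * nm x = C * nm h * (cW * nm x) by ring.
  by rewrite ler_wpM2l ?mulr_ge0 ?nm_ge0.
have kernelE w la u : Omega w -> Omega la ->
    HU_kernel J1 U w la u = 2^-1 *: F la (Fs w u).
  move=> Ow Ol; rewrite /HU_kernel; case: ifPn => [/eqP lE|law].
    rewrite -lE; subst la.
    (* On the vector [J1 (adjoint (U w) u)], [U] agrees with [K w _ u] near [w^*] by [UUs], so both
       have the same derivative there; the term with [rho] vanishes at [w^*]. *)
    have -> : op_derive U w^* (J1 (adjoint (U w) u)) = pii *: F w^* (Fs w u).
      rewrite (op_deriveE (U_deriv _ Ol)).
      have [C1 [d1 [C10 d10 hd1]]] :=
        Jker_deriv Omega_open P_adj tau_adj P_res tau_res Ob Ol.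
      have [C2 [d2 [C20 d20 hd2]]] :=
        Jker_deriv Omega_open P_adj tau_adj P_res tau_res Ow Ol.
      set x := J1 _.
      apply: (@quotient_lim_uniq _ _
        (fun h => h^-1 *: (U (h + w^*) x - U w^* x)) _ _
        (C1 * nm (W x)) (C2 * nm u) d1 d2) => // h h0 hd.
        have [_ /(_ (W x))] := hd1 h h0 hd.
        by rewrite [C1 * nm (W x) * _]mulrAC.
      have [Oh /(_ u)] := hd2 h h0 hd.
      rewrite rhoE subrr mulr0 oppr0 mul0r scale0r subr0 [C2 * nm u * _]mulrAC.
      by rewrite /x !UUs.
    by rewrite scalerA -[2 * _ * _]mulrA -/pii invfM mulfVK ?pii_neq0.
  rewrite UUs// /K /Jker opprB addrC subrK scalerA; congr (_ *: _).
  rewrite mulrA mulVf ?mul1r// rhoE oppr_eq0 mulf_eq0 subr_eq0 negb_or law andbT.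
  by rewrite mulf_neq0 ?pnatr_eq0// pii_neq0.
exists U; split.
- move=> z Oz; split; first exact: adjp_bounded_op (UA _ Oz).
  by eexists; exact: U_deriv.
- move=> la Ol u; split; last exact: UsU.
  rewrite UUs//; last exact: Omega_conj.
  by have := Jker_conj P Ps tau taus la^* u; rewrite conjCK.
split.
- move=> n om u Oom.
  have -> : \sum_i \sum_j inner (HU_kernel J1 U (om j) (om i) (u j)) (u i) =
      2^-1 * inner (\sum_j Fs (om j) (u j)) (\sum_j Fs (om j) (u j)).
    rewrite sum_innerr mulr_sumr; apply: eq_bigr => i _.
    rewrite sum_innerl mulr_sumr; apply: eq_bigr => j _.
    by rewrite kernelE// innerZl FA.
  by rewrite mulr_ge0 ?invr_ge0// inner_nm ler0c sqr_ge0.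
- exact: H1_hilbert.
- move=> _ [f _ <-] z Oz.
  have [C [d [C0 d0 hd]]] := ev_deriv Omega_open P_adj tau_adj P_res tau_res Oz.
  apply: (@derivable_bound _ _ _ _ (F z (tau z f)) (C * nm f) d) => // h h0 hhd.
  have [Oh /(_ f)] := hd h h0 hhd.
  by rewrite !H1_funE// [C * nm f * _]mulrAC.
- move=> w Ow u.
  (* The factor 1/2 compensates the 2 in the inner product of H1. *)
  have -> : on_set Omega (fun la => HU_kernel J1 U w la u) =
      H1_fun E Y Omega (2^-1 *: Fs w u).
    apply/funext => la; have [Ol|Ol] := pselect (Omega la); last first.
      by rewrite H1_fun_off// /on_set /patch memNset.
    rewrite H1_funE// /on_set patchT ?inE// kernelE//.
    by rewrite (linZ (adjp_linear (FA _ Ol))).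
  split; first by exists (2^-1 *: Fs w u).
  move=> _ [f _ <-]; rewrite innerE innerZr H1_funE// FA//.
  by rewrite fmorphV rmorph_nat mulrA divff ?mul1r// pnatr_eq0.
Qed.

End SymmetricOperator.

Lemma J1_signature (R : realType) (X : hilbertType R) :
  signature_op (J1 : hsum X X -> hsum X X).
Proof.
split; [exact: adjp_bounded_op J1_adjp|exact: J1_adjp|exact: J1K].
Qed.

Theorem theorem3p3 (R : realType) (X : hilbertType R)
  (X_separable : separable X)
  (X_infinite : infinite_dim [set: X])
  (E : linop X)
  (E_simple : simple_op E)
  (E_closed : closed_op E)
  (E_dense : dense (dom E))
  (E_symmetric : symmetric_op E)
  (E_deficiency : infinite_deficiency_indices E)
  (Y : set X)
  (Y_subspace : lin_subspace Y)
  (Y_closed : closed Y)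
  (Y_infinite : infinite_dim Y)
  (Omega : set R[i]^o)
  (Omega_nonempty : Omega !=set0)
  (Omega_open : open Omega)
  (Omega_conj : forall xi : R[i], Omega xi -> Omega xi^*)
  (Omega_regular : forall xi : R[i], Omega xi -> regular_point E Y xi) :
  exists U : R[i] -> hsum X X -> hsum X X,
    [/\ signature_op (J1 : hsum X X -> hsum X X),
        op_analytic Omega U,
        J_identity Omega J1 U &
        is_HU Omega J1 U (H1 E Y Omega)].
Proof.
have [U [U_analytic U_J U_HU]] := H1_is_HU E_simple E_closed E_symmetric
  Y_subspace Y_closed Omega_nonempty Omega_open Omega_conj Omega_regular.
by exists U; split=> //; exact: J1_signature.
Qed.
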